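(* Let $G$ be a prime $(P_5,\overline{P_5},Bull)$-sparse graph. Then $G$ or its complement $\overline{G}$ is either a $C_5$, or a $P_5$-free bipartite graph, or a bundle of $P_5$'s, or a graph on less than $10$ vertices.
   Context: All graphs are finite, simple and undirected. $P_5$ is the chordless path on $5$ vertices, $\overline{P_5}$ its complement, $C_5$ the chordless cycle on $5$ vertices, and the Bull is the graph on $\{1,2,3,4,5\}$ with edges $12,23,34,25,35$. ''$P_5$-free'' means having no induced subgraph isomorphic to $P_5$. A graph $G$ is $(P_5,\overline{P_5},Bull)$-sparse if every set of $6$ vertices of $G$ contains at most one $5$-element subset inducing a graph isomorphic to $P_5$, $\overline{P_5}$ or the Bull. A module of a graph $G=(V,E)$ is a set $M\subseteq V$ such that every vertex outside $M$ is adjacent either to all vertices of $M$ or to none of them. $G$ is prime if its only modules are $\emptyset$, the singletons, and $V$. A bundle of $P_5$'s is, for some integer $k\ge 2$, the graph with a vertex $x$, vertices $u_1,\dots,u_k,v_1,\dots,v_k$, and possibly one additional vertex $y$, whose edges are exactly $xu_i$ and $u_iv_i$ for $1\le i\le k$, together with $xy$ if $y$ is present. *)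

(* Defs.v *)
From mathcomp Require Import all_boot.

Set Implicit Arguments.
Unset Strict Implicit.
Unset Printing Implicit Defensive.

Record sgraph := SGraph {
  vertex :> finType;
  adj : rel vertex;
  adj_sym : symmetric adj;
  adj_irrefl : irreflexive adj
}.

(* The simple graph on T whose edges are the pairs related by r in either
   direction, loops being discarded. *)
Section OfRel.
Variables (T : finType) (r : rel T).

Definition rel_adj : rel T := fun x y => (x != y) && (r x y || r y x).

Fact rel_adj_sym : symmetric rel_adj.
Proof. by move=> x y; rewrite /rel_adj eq_sym orbC. Qed.

Fact rel_adj_irrefl : irreflexive rel_adj.
Proof. by move=> x; rewrite /rel_adj eqxx. Qed.

Definition graph_of_rel : sgraph := SGraph rel_adj_sym rel_adj_irrefl.
End OfRel.

Section Complement.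
Variable G : sgraph.

Definition compl_adj : rel G := fun x y => (x != y) && ~~ adj x y.

Fact compl_adj_sym : symmetric compl_adj.
Proof. by move=> x y; rewrite /compl_adj eq_sym adj_sym. Qed.

Fact compl_adj_irrefl : irreflexive compl_adj.
Proof. by move=> x; rewrite /compl_adj eqxx. Qed.

Definition complement : sgraph := SGraph compl_adj_sym compl_adj_irrefl.
End Complement.

Section Induced.
Variables (G : sgraph) (A : {set G}).

Definition induced_adj : rel {x : G | x \in A} :=
  fun x y => adj (val x) (val y).

Fact induced_adj_sym : symmetric induced_adj.
Proof. by move=> x y; apply: adj_sym. Qed.

Fact induced_adj_irrefl : irreflexive induced_adj.
Proof. by move=> x; apply: adj_irrefl. Qed.

Definition induced : sgraph := SGraph induced_adj_sym induced_adj_irrefl.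
End Induced.

Definition isomorphic (G H : sgraph) : Prop :=
  exists2 f : G -> H, bijective f & forall x y, adj (f x) (f y) = adj x y.

Definition P5 : sgraph :=
  graph_of_rel (fun i j : 'I_5 => j == i.+1 :> nat).

Definition C5 : sgraph :=
  graph_of_rel (fun i j : 'I_5 => j == i.+1 %% 5 :> nat).

(* The vertices 1, ..., 5 of the Bull are encoded as 0, ..., 4 in 'I_5. *)
Definition Bull : sgraph :=
  graph_of_rel (fun i j : 'I_5 =>
    (i.+1, j.+1) \in [:: (1, 2); (2, 3); (3, 4); (2, 5); (3, 5)]).

Definition P5_free (G : sgraph) : Prop :=
  forall A : {set G}, ~ isomorphic (induced A) P5.

Definition bipartite (G : sgraph) : Prop :=
  exists A : {set G}, forall x y : G, adj x y -> (x \in A) != (y \in A).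

Definition P5_coP5_Bull (H : sgraph) : Prop :=
  [\/ isomorphic H P5, isomorphic H (complement P5) | isomorphic H Bull].

Definition P5_coP5_Bull_sparse (G : sgraph) : Prop :=
  forall S : {set G}, #|S| = 6 ->
  forall A B : {set G}, A \subset S -> B \subset S -> #|A| = 5 -> #|B| = 5 ->
    P5_coP5_Bull (induced A) -> P5_coP5_Bull (induced B) -> A = B.

Definition is_module (G : sgraph) (M : {set G}) : Prop :=
  forall x : G, x \notin M ->
    (forall y, y \in M -> adj x y) \/ (forall y, y \in M -> ~~ adj x y).

Definition prime_graph (G : sgraph) : Prop :=
  forall M : {set G}, is_module M ->
    [\/ M = set0, exists x, M = [set x] | M = [set: G]].

(* inl (inl tt) is x, inl (inr _) is the optional y (present iff b = true),
   inr (inl i) is u_i and inr (inr i) is v_i. *)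
Definition bundle_vertex (k : nat) (b : bool) : finType :=
  ((unit + 'I_b) + ('I_k + 'I_k))%type.

Definition bundle_rel (k : nat) (b : bool) : rel (bundle_vertex k b) :=
  fun p q => match p, q with
  | inl (inl _), inr (inl _) => true
  | inr (inl i), inr (inr j) => i == j
  | inl (inl _), inl (inr _) => true
  | _, _ => false
  end.

Definition bundle_graph (k : nat) (b : bool) : sgraph :=
  graph_of_rel (@bundle_rel k b).

Definition P5_bundle (G : sgraph) : Prop :=
  exists (k : nat) (b : bool), 2 <= k /\ isomorphic G (bundle_graph k b).

(* Main.v *)
Require Import Defs.
From mathcomp Require Import all_boot.
From mathcomp Require Import zify.

Set Implicit Arguments.
Unset Strict Implicit.
Unset Printing Implicit Defensive.

(* Only graphs on at least 10 vertices matter. Let X be a proper vertex subset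
   with at least two elements of a prime graph G. Some vertex outside X has a
   new type over X (neither complete nor anticomplete to X, nor a twin of an
   element of X), or some twin y of an element u of X is told apart from u by a
   vertex which is not a twin of u; otherwise the twin classes, and then X
   itself, would be modules. Growing X in these two ways gives a finite search
   tree in each of the following situations, because the excluded
   configurations leave few types:
   - a sparse G containing P5 contains the bundle with k = 3;
   - a sparse G contains no Bull;
   - if G has no induced P5, co-P5 or Bull, then it has no C5 either;
   - if moreover G contains P4 (as every prime graph on more than 2 vertices
     does), then G or its complement contains the bipartite half graph on
     6 vertices.
   In the first case a maximal bundle together with the vertices adjacent only
   to its centre is a module. In the last case a maximal half graph is all of
   G, since a twin class over it that is not a module produces a larger one. *)

(** * Adjacency codes of vertex sequences *)

Section Code.
Variable T : eqType.
Implicit Types (r : rel T) (s : seq T).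

(* The upper triangle of the adjacency matrix of s, row by row. *)
Fixpoint code (r : rel T) (s : seq T) : seq bool :=
  if s is x :: s' then map (r x) s' ++ code r s' else [::].

Lemma eq_in_code r r' s :
  {in s &, r =2 r'} -> code r s = code r' s.
Proof.
elim: s => //= x s IHs Hr; congr (_ ++ _).
  by apply/eq_in_map => y ys; apply: Hr; rewrite inE ?eqxx // ys orbT.
by apply: IHs => y z ys zs; apply: Hr; rewrite inE ?ys ?zs orbT.
Qed.

End Code.

Lemma code_map (T T' : eqType) (f : T -> T') (r : rel T') s :
  code r (map f s) = code (relpre f r) s.
Proof. by elim: s => //= x s ->; rewrite -map_comp. Qed.

Lemma size_code (T : eqType) (r : rel T) s :
  size (code r s) = 'C(size s, 2).
Proof.
by elim: s => //= x s IHs; rewrite size_cat size_map IHs binS bin1 addnC.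
Qed.

Lemma code_nth (T T' : eqType) (r : rel T) (r' : rel T') x0 x0' s s' i j :
  size s = size s' -> code r s = code r' s' -> i < j < size s ->
  r (nth x0 s i) (nth x0 s j) = r' (nth x0' s' i) (nth x0' s' j).
Proof.
elim: s s' i j => [|x s IHs] [|x' s'] i j //=; first by rewrite ltn0 andbF.
move=> [sz] /eqP; rewrite eqseq_cat ?size_map ?sz // => /andP[/eqP Ex /eqP Es].
case: i j => [|i] [|j] //= ij; last first.
  by apply: (IHs _ _ _ sz Es); rewrite sz.
rewrite ltnS in ij.
have := congr1 (nth false ^~ j) Ex; by rewrite (nth_map x0) ?sz // (nth_map x0').
Qed.

(** * Lookup tables for five-vertex graphs *)

Inductive trie := Leaf of bool | Node of trie & trie.

Fixpoint tabulate n (f : seq bool -> bool) : trie :=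
  if n is n'.+1 then
    Node (tabulate n' (fun s => f (false :: s))) (tabulate n' (fun s => f (true :: s)))
  else Leaf (f [::]).

Fixpoint lookup (t : trie) (s : seq bool) : bool :=
  match t, s with
  | Leaf b, _ => b
  | Node t0 t1, b :: s' => if b then lookup t1 s' else lookup t0 s'
  | Node _ _, [::] => false
  end.

Lemma lookup_tabulate f s : lookup (tabulate (size s) f) s = f s.
Proof. by elim: s f => //= -[] s IHs f; rewrite IHs. Qed.

Definition patP5 : rel nat := fun i j => (j == i.+1) || (i == j.+1).
Definition patcoP5 : rel nat := fun i j => (i != j) && ~~ patP5 i j.
Definition patC5 : rel nat := fun i j => (j == i.+1 %% 5) || (i == j.+1 %% 5).
Definition patBull : rel nat := fun i j =>
  let l := [:: (1, 2); (2, 3); (3, 4); (2, 5); (3, 5)] in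
  ((i.+1, j.+1) \in l) || ((j.+1, i.+1) \in l).

(** A code depends on the order of the vertices, so all 120 orders are listed; membership then
    depends on the isomorphism type only. *)
Definition pcodes (e : rel nat) := map (code e) (permutations (iota 0 5)).
Definition bad_codes := undup (pcodes patP5 ++ pcodes patcoP5 ++ pcodes patBull).

(* Tabulated, because the searches below look up many codes. *)
Definition badT := Eval vm_compute in
  tabulate 10 (fun s => s \in bad_codes).
Definition freeT := Eval vm_compute in
  tabulate 10 (fun s => s \in bad_codes ++ pcodes patC5).

Definition is_bad s := lookup badT s.
(** $P_5$, its complement, the Bull and $C_5$ are exactly the prime graphs on five vertices. *)
Definition is_prime5 s := lookup freeT s.

Lemma is_badE s : size s = 10 -> is_bad s = (s \in bad_codes).
Proof.
move=> sz; rewrite /is_bad.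
have -> : badT = tabulate (size s) (fun s => s \in bad_codes).
  by rewrite sz; vm_compute.
exact: lookup_tabulate.
Qed.

Lemma is_prime5E s :
  size s = 10 -> is_prime5 s = is_bad s || (s \in pcodes patC5).
Proof.
move=> sz; rewrite is_badE // -mem_cat /is_prime5.
have -> : freeT = tabulate (size s) (fun s => s \in bad_codes ++ pcodes patC5).
  by rewrite sz; vm_compute.
exact: (lookup_tabulate (fun s => s \in bad_codes ++ pcodes patC5)).
Qed.

Fixpoint allbits n : seq (seq bool) :=
  if n is n'.+1 then
    map (cons false) (allbits n') ++ map (cons true) (allbits n')
  else [:: [::]].

Lemma mem_allbits s : s \in allbits (size s).
Proof.
by elim: s => //= -[] s IHs; rewrite mem_cat (map_f (cons _)) ?orbT.
Qed.

(** The family is closed under complement, the Bull being self-complementary; this is checked on all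
    $2^{10}$ codes. *)
Lemma is_bad_compl s : size s = 10 -> is_bad (map negb s) = is_bad s.
Proof.
move=> sz.
have /allP H : all (fun s => is_bad (map negb s) == is_bad s) (allbits 10).
  by vm_compute.
by apply/eqP/H; rewrite -sz mem_allbits.
Qed.

Lemma is_prime5_compl s : size s = 10 -> is_prime5 (map negb s) = is_prime5 s.
Proof.
move=> sz.
have /allP H : all (fun s => is_prime5 (map negb s) == is_prime5 s) (allbits 10).
  by vm_compute.
by apply/eqP/H; rewrite -sz mem_allbits.
Qed.

(** * Codes and isomorphism types of induced subgraphs *)

Section Graph.
Variable G : sgraph.
Implicit Types (xs ys zs : seq G).

Lemma code_compl ys : uniq ys ->
  code (@adj (complement G)) ys = map negb (code (@adj G) ys).
Proof.
elim: ys => //= x ys IHs /andP[xys uys]; rewrite map_cat IHs //; congr (_ ++ _).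
rewrite -map_comp; apply/eq_in_map => y yys /=; rewrite /compl_adj.
by case: eqP yys xys => // ->  ->.
Qed.

(** The i-th entry of [ys] is sent to [h] of the i-th entry of [p]. Codes only compare positions i <
    j; symmetry of adjacency covers the other pairs. *)
Lemma code_iso (H : sgraph) (h : 'I_5 -> H) (e : rel nat) ys p :
  bijective h -> (forall i j : 'I_5, adj (h i) (h j) = e i j) ->
  uniq ys -> size ys = 5 -> p \in permutations (iota 0 5) ->
  code (@adj G) ys = code e p -> isomorphic (induced [set y in ys]) H.
Proof.
move=> bh hE uys sys; rewrite mem_permutations => pp cE.
have up : uniq p by rewrite (perm_uniq pp) iota_uniq.
have sp : size p = 5 by rewrite (perm_size pp) size_iota.
have pl i : i < 5 -> nth 0 p i < 5.
  move=> i5; have := @mem_nth _ 0 p i; rewrite sp (perm_mem pp) mem_iota; exact.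

have esym i j : i < 5 -> j < 5 -> e i j = e j i.
  by move=> i5 j5; rewrite -(hE (Ordinal i5) (Ordinal j5)) adj_sym hE.
have eirr i : i < 5 -> e i i = false.
  by move=> i5; rewrite -(hE (Ordinal i5) (Ordinal i5)) adj_irrefl.
have x0 : G by move: sys; case: (ys).
pose ix (x : {x : G | x \in [set y in ys]}) := index (val x) ys.
have ixl x : ix x < 5.
  by rewrite -sys index_mem; have := valP x; rewrite inE.
have ixK x : nth x0 ys (ix x) = val x.
  by rewrite nth_index //; have := valP x; rewrite inE.
pose f x := h (inord (nth 0 p (ix x))).
have fval x : (inord (nth 0 p (ix x)) : 'I_5) = nth 0 p (ix x) :> nat.
  by rewrite inordK ?pl.
have injf : injective f.
  move=> x y /(bij_inj bh) /(congr1 val); rewrite /= !fval => /eqP.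
  by rewrite nth_uniq ?sp // => /eqP E; apply: val_inj; rewrite -ixK E ixK.
exists f.
  apply: inj_card_bij => //.
  rewrite -(bij_eq_card bh) card_ord.
  by rewrite card_sig -sys -(card_uniqP uys); apply: eq_leq; apply: eq_card => z; rewrite !inE.
have main x y : ix x < ix y -> adj (f x) (f y) = @adj (induced _) x y.
  move=> xy; rewrite hE !fval /= /induced_adj -!ixK.
  by rewrite (code_nth x0 0 _ cE) ?sp ?sys // xy ixl.
move=> x y; case: (ltngtP (ix x) (ix y)) => [|yx|E]; first exact: main.
  by rewrite adj_sym main // adj_sym.
have -> : x = y by apply: val_inj; rewrite -ixK E ixK.
by rewrite !adj_irrefl.
Qed.

Lemma P5_patE (i j : 'I_5) : @adj P5 i j = patP5 i j.
Proof.
rewrite /= /rel_adj /= /patP5; case: eqP => //= ->.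
by rewrite orbb; apply/esym/eqP; lia.
Qed.

Lemma bad_iso ys : uniq ys -> size ys = 5 -> is_bad (code (@adj G) ys) ->
  P5_coP5_Bull (induced [set y in ys]).
Proof.
move=> uys sys; rewrite is_badE ?size_code ?sys // mem_undup !mem_cat.
have bid : bijective (@id 'I_5) by exists id.
case/or3P => /mapP[p pp cE].
- by apply: Or31; apply: (@code_iso P5 id _ _ _ bid _ uys sys pp cE) => i j; exact: P5_patE.
- apply: Or32; apply: (@code_iso (complement P5) id _ _ _ bid _ uys sys pp cE) => i j.
  by rewrite /= /compl_adj P5_patE.
- apply: Or33; apply: (@code_iso Bull id _ _ _ bid _ uys sys pp cE) => i j.
  rewrite /= /rel_adj /= /patBull /=.
  by case: (i) (j) => [[|[|[|[|[|i']]]]] Hi] [[|[|[|[|[|j']]]]] Hj].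
Qed.

(** Induced containment of [e]. A single order of the pattern suffices, since [ys] may be
    rearranged. *)
Definition has_pat (e : rel nat) (n : nat) :=
  exists2 ys, uniq ys & size ys = n /\ code (@adj G) ys = code e (iota 0 n).

Lemma iso_has_pat (A : {set G}) (H : sgraph) (h : 'I_5 -> H) (e : rel nat) :
  injective h -> (forall i j : 'I_5, adj (h i) (h j) = e i j) ->
  isomorphic (induced A) H -> has_pat e 5.
Proof.
move=> ih hE [f [g fK gK] fE].
exists (map (fun i : nat => val (g (h (inord i)))) (iota 0 5)).
  rewrite map_inj_in_uniq ?iota_uniq // => i j; rewrite !mem_iota /= add0n => i5 j5.
  move/val_inj/(can_inj gK)/ih/(congr1 val) => /=.
  by rewrite !inordK.
rewrite size_map size_iota; split=> //; rewrite code_map; apply: eq_in_code => i j.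
rewrite !mem_iota /= add0n => i5 j5.
have := fE (g (h (inord i))) (g (h (inord j))).
by rewrite !gK hE !inordK.
Qed.

End Graph.

(** * Sparsity and avoidance in terms of codes *)

Definition del (T : Type) i (s : seq T) := take i s ++ drop i.+1 s.

Fixpoint atmost1 (s : seq bool) : bool :=
  if s is b :: s' then if b then ~~ has id s' else atmost1 s' else true.

Lemma atmost1PN s : ~~ atmost1 s ->
  exists i j, [/\ i < j < size s, nth false s i & nth false s j].
Proof.
elim: s => //= -[] s IHs.
  rewrite negbK => /(hasP) [b /(nthP false) [j js <-] jt].
  by exists 0, j.+1.
by move=> /IHs [i [j [ij ti tj]]]; exists i.+1, j.+1.
Qed.

Definition sparse6 (G : sgraph) := forall zs : seq G, uniq zs -> size zs = 6 ->
  atmost1 [seq is_bad (code (@adj G) (del i zs)) | i <- iota 0 6].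

Definition avoids5 (t : seq bool -> bool) (G : sgraph) :=
  forall ys : seq G, uniq ys -> size ys = 5 -> ~~ t (code (@adj G) ys).

Lemma size_del (T : Type) i (s : seq T) : i < size s -> size (del i s) = (size s).-1.
Proof. by move=> si; rewrite size_cat size_takel ?size_drop; lia. Qed.

Lemma del_subseq (T : eqType) i (s : seq T) : subseq (del i s) s.
Proof.
rewrite -{2}(cat_take_drop i s) cat_subseq // -addn1 addnC -drop_drop.
exact: drop_subseq.
Qed.

Lemma map_del (T T' : Type) (f : T -> T') i s : map f (del i s) = del i (map f s).
Proof. by rewrite map_cat map_take map_drop. Qed.

(** If deleting positions i < j gave two bad codes, sparsity would identify the two five-element
    sets, but the i-th entry lies in the second and not in the first. *)
Lemma sparse_sparse6 G : P5_coP5_Bull_sparse G -> sparse6 G.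
Proof.
move=> spG zs uz sz; apply: contraT => /atmost1PN[i [j]].
rewrite size_map size_iota => -[/andP[ij j6]].
rewrite !(nth_map 0) ?size_iota ?nth_iota ?add0n //; try lia.
have i6 : i < 6 by lia.
have ud k : uniq (del k zs) by exact: subseq_uniq (del_subseq _ _) uz.
move=> /bad_iso Bi /bad_iso Bj.
have sd k : k < 6 -> size (del k zs) = 5 by move=> k6; rewrite size_del sz.
have sub k : [set y in del k zs] \subset [set y in zs].
  by apply/subsetP => y; rewrite !inE; exact: mem_subseq (del_subseq _ _) _.
have cd k : k < 6 -> #|[set y in del k zs]| = 5 by move=> k6; rewrite cardsE (card_uniqP _) ?sd.
have := spG [set y in zs] _ _ _ (sub i) (sub j) (cd i i6) (cd j j6).
rewrite cardsE (card_uniqP uz) sz => /(_ erefl (Bi (ud _) (sd _ i6)) (Bj (ud _) (sd _ j6))).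
have x0 : G by move: sz; case: (zs).
move=> /setP/(_ (nth x0 zs i)); rewrite !inE.
have -> : nth x0 zs i \in del j zs.
  rewrite mem_cat; apply/orP; left.
  by rewrite -(nth_take x0 ij) mem_nth // size_takel // sz; lia.
rewrite mem_cat => /orP yin.
move: uz; rewrite -{1}(cat_take_drop i zs) cat_uniq (drop_nth x0) ?sz //=.
case/and4P=> _; rewrite negb_or => /andP[/negbTE nt _] /negbTE nd _.
by case: yin; rewrite ?nt ?nd.
Qed.

Lemma sparse6_compl G : sparse6 G -> sparse6 (complement G).
Proof.
move=> spG zs uz sz; have := spG zs uz sz; congr atmost1.
apply/eq_in_map => i; rewrite mem_iota add0n /= => i6.
rewrite code_compl ?is_bad_compl ?size_code ?size_del ?sz //; last first.
  exact: subseq_uniq (del_subseq _ _) uz.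
Qed.

Lemma avoids5_compl t G :
  (forall s, size s = 10 -> t (map negb s) = t s) ->
  avoids5 t G -> avoids5 t (complement G).
Proof. by move=> tE av ys uy sy; rewrite code_compl // tE ?size_code ?sy ?av. Qed.

(** * Adjacency matrices and types of outside vertices *)

Section Matrix.
Variable G : sgraph.
Implicit Types (xs : seq G).

Definition mx xs : seq (seq bool) := [seq [seq adj x y | y <- xs] | x <- xs].
Definition ty (z : G) xs : seq bool := [seq adj z x | x <- xs].

End Matrix.

Definition mget (m : seq (seq bool)) i j := nth false (nth [::] m i) j.

(** A new vertex goes in front: it gets index 0 and the others are shifted by one, which is what
    [focus] relies on. *)
Definition ins (t : seq bool) (m : seq (seq bool)) : seq (seq bool) :=
  (false :: t) :: [seq bt.1 :: bt.2 | bt <- zip t m].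

Lemma mx_cons (G : sgraph) (z : G) xs : mx (z :: xs) = ins (ty z xs) (mx xs).
Proof.
rewrite /mx /= adj_irrefl /ins; congr (_ :: _).
rewrite /ty zip_map -map_comp; apply: eq_map => x /=.
by rewrite adj_sym.
Qed.

Lemma mgetE (G : sgraph) (x0 : G) xs i j : i < size xs -> j < size xs ->
  mget (mx xs) i j = adj (nth x0 xs i) (nth x0 xs j).
Proof. by move=> ix jx; rewrite /mget (nth_map x0) // (nth_map x0). Qed.

Lemma code_mget (G : sgraph) (x0 : G) xs idx :
  all (fun i => i < size xs) idx ->
  code (mget (mx xs)) idx = code (@adj G) (map (nth x0 xs) idx).
Proof.
move=> /allP il; rewrite code_map; apply: eq_in_code => i j /il ix /il jx.
by rewrite (mgetE x0).
Qed.

Fixpoint subs (T : Type) k (s : seq T) : seq (seq T) :=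
  match k, s with
  | 0, _ => [:: [::]]
  | _, [::] => [::]
  | k'.+1, x :: s' => [seq x :: q | q <- subs k' s'] ++ subs k s'
  end.

Lemma mem_subs (T : eqType) k (s q : seq T) :
  q \in subs k s -> subseq q s /\ size q = k.
Proof.
elim: s k q => [|x s IHs] [|k] q; try by rewrite ?inE ?mem_seq1 => // /eqP->; rewrite ?sub0seq.
rewrite /= mem_cat => /orP[/mapP[q' /IHs[sq <-] ->]|/IHs[sq <-]].
  by rewrite /= eqxx.
by split=> //; exact: subseq_trans sq (subseq_cons _ _).
Qed.

(* In a search, all subsets avoiding one of the two latest vertices 0 and 1
   have been examined earlier. *)
Definition focus k (m : seq (seq bool)) :=
  map (fun q => 0 :: 1 :: q) (subs k (iota 2 (size m - 2))).

(* Unlike [all], this stops at the first failure under call by value. *)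
Fixpoint every (T : Type) (p : pred T) s :=
  if s is x :: s' then if p x then every p s' else false else true.

Lemma everyE (T : Type) (p : pred T) s : every p s = all p s.
Proof. by elim: s => //= x s ->; case: (p x). Qed.

Definition chk_sparse (m : seq (seq bool)) :=
  every (fun q => atmost1 [seq is_bad (code (mget m) (del i q)) | i <- iota 0 6])
      (focus 4 m).

Definition chk_avoid (t : seq bool -> bool) (m : seq (seq bool)) :=
  every (fun q => ~~ t (code (mget m) q)) (focus 3 m).

Lemma mem_focus k n (m : seq (seq bool)) q : size m = n -> 0 < k -> q \in focus k m ->
  [/\ uniq q, all (fun i => i < n) q & size q = k.+2].
Proof.
move=> sm k0 /mapP[p /mem_subs[sp szp] ->].
have [up al] : uniq p /\ {subset p <= iota 2 (size m - 2)}.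
  by split; [exact: subseq_uniq sp (iota_uniq _ _) | exact: mem_subseq].
(* Since k > 0, some index from 2 on is present, so 0 and 1 are valid indices too. *)
have n2 : 2 < n.
  rewrite -sm; have := size_subseq sp; rewrite size_iota szp; lia.
split=> /=; last by rewrite szp.
  rewrite !inE !negb_or up andbT /=; apply/andP; split.
    by apply/negP => /al; rewrite mem_iota.
  by apply/negP => /al; rewrite mem_iota.
rewrite (ltn_trans _ n2) // (ltnW n2) /=; apply/allP => i /al.
by rewrite mem_iota sm; lia.
Qed.

Lemma size_mx (G : sgraph) (xs : seq G) : size (mx xs) = size xs.
Proof. by rewrite size_map. Qed.

Lemma uniq_map_nth (T : eqType) (x0 : T) xs idx : uniq xs -> uniq idx ->
  all (fun i => i < size xs) idx -> uniq (map (nth x0 xs) idx).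
Proof.
move=> ux ui /allP al; rewrite map_inj_in_uniq // => i j /al ix /al jx /eqP.
by rewrite nth_uniq // => /eqP.
Qed.

Lemma all_del (p : pred nat) i q : all p q -> all p (del i q).
Proof. by move=> /allP a; apply/allP => x /(mem_subseq (del_subseq _ _)) /a. Qed.

Lemma chk_sparse_sound (G : sgraph) (xs : seq G) : sparse6 G -> uniq xs -> chk_sparse (mx xs).
Proof.
move=> spG ux; rewrite /chk_sparse everyE; apply/allP => q.
case/(mem_focus (size_mx xs) (ltn0Sn _)) => uq aq sq.
have [x0 _|] := pickP (mem [set: G]); last first.
  by case: xs ux aq => [|x xs] _ aq; [case: q uq aq sq | move/(_ x); rewrite !inE].
have := spG (map (nth x0 xs) q); rewrite uniq_map_nth // size_map => /(_ isT sq).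
congr atmost1; apply/eq_in_map => i _; rewrite -map_del (code_mget x0) //.
exact: all_del.
Qed.

Lemma chk_avoid_sound t (G : sgraph) (xs : seq G) :
  avoids5 t G -> uniq xs -> chk_avoid t (mx xs).
Proof.
move=> avG ux; rewrite /chk_avoid everyE; apply/allP => q.
case/(mem_focus (size_mx xs) (ltn0Sn _)) => uq aq sq.
have [x0 _|] := pickP (mem [set: G]); last first.
  by case: xs ux aq => [|x xs] _ aq; [case: q uq aq sq | move/(_ x); rewrite !inE].
have := avG (map (nth x0 xs) q); rewrite uniq_map_nth // size_map => /(_ isT sq).
by rewrite (code_mget x0).
Qed.

(** * Backtracking search for a pattern in a matrix *)

Section Find.
Variables (m : seq (seq bool)) (e : rel nat).

Fixpoint any (T : Type) (p : pred T) s :=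
  if s is x :: s' then if p x then true else any p s' else false.

(** Images are chosen from the last pattern vertex down to the first: [acc] holds the images of [j],
    [j.+1] and so on, so that each step checks just one new row of the code. *)
Fixpoint find_pat n j (acc : seq nat) : bool :=
  if j is j'.+1 then
    any (fun v => if (v \notin acc) &&
                     (map (mget m v) acc == map (e j') (iota j (size acc)))
                  then find_pat n j' (v :: acc) else false) (iota 0 n)
  else true.

Lemma anyE (T : Type) (p : pred T) s : any p s = has p s.
Proof. by elim: s => //= x s ->; case: (p x). Qed.

Lemma find_patP n j acc :
  find_pat n j acc -> uniq acc -> all (fun i => i < n) acc ->
  code (mget m) acc = code e (iota j (size acc)) ->
  exists2 idx, uniq idx & [/\ all (fun i => i < n) idx, size idx = j + size acc &
    code (mget m) idx = code e (iota 0 (j + size acc))].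
Proof.
elim: j acc => [|j IHj] acc /=; first by move=> _ ua aa ca; exists acc.
rewrite anyE => /hasP[v]; rewrite mem_iota add0n /= => vn.
case: ifP => // /andP[va /eqP E] /IHj {}IHj ua aa ca.
have uva : uniq (v :: acc) by rewrite /= va.
have ava : all (fun i => i < n) (v :: acc) by rewrite /= vn.
have [|idx uidx H] := IHj uva ava; first by rewrite /= E ca.
by rewrite /= addnS in H; exists idx; rewrite // addSn.
Qed.

End Find.

Lemma find_pat_sound (G : sgraph) (xs : seq G) e k : uniq xs ->
  find_pat (mx xs) e (size xs) k [::] -> has_pat G e k.
Proof.
move=> ux /find_patP [] // idx uidx; rewrite addn0 => -[aidx sidx cidx].
have [x0 _|x0] := pickP (mem [set: G]); last first.
  exists [::] => //; move: aidx sidx cidx.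
  case: xs {ux} => [|x ?]; last by have := x0 x; rewrite !inE.
  by case: idx {uidx} => // _ <-.
exists (map (nth x0 xs) idx); first exact: uniq_map_nth.
by rewrite size_map -code_mget.
Qed.

(** * Twins and extensions in prime graphs *)

(** The entry at [i] is ignored, so that adjacent and non-adjacent twins are both allowed. *)
Definition twinb (m : seq (seq bool)) i (s : seq bool) :=
  all (fun j => (j == i) || (nth false s j == mget m i j)) (iota 0 (size m)).

Definition extb (m : seq (seq bool)) (s : seq bool) :=
  [&& has id s, ~~ all id s & ~~ has (fun i => twinb m i s) (iota 0 (size m))].

Lemma twinbP (G : sgraph) (x0 : G) xs i z : uniq xs -> i < size xs ->
  reflect (forall v, v \in xs -> v != nth x0 xs i -> adj z v = adj (nth x0 xs i) v)
          (twinb (mx xs) i (ty z xs)).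
Proof.
move=> ux ix; rewrite /twinb size_mx; apply: (iffP allP) => [H v vx vi|H j].
  have jx : index v xs < size xs by rewrite index_mem.
  have := H (index v xs); rewrite mem_iota add0n /= jx (mgetE x0) // (nth_map x0) //.
  rewrite nth_index //; case: eqP => [ji|_ /(_ isT) /eqP//].
  by rewrite -ji nth_index ?eqxx in vi.
rewrite mem_iota add0n /= => jx; case: eqP => //= /eqP ji.
by rewrite (mgetE x0) // (nth_map x0) // H ?mem_nth // nth_uniq.
Qed.

Lemma prime_extension (G : sgraph) (x0 : G) xs :
  prime_graph G -> uniq xs -> 1 < size xs < #|G| ->
  (exists2 z, z \notin xs & extb (mx xs) (ty z xs)) \/
  exists i y w, [/\ i < size xs, y \notin xs /\ twinb (mx xs) i (ty y xs),
    w \notin xs, ~~ twinb (mx xs) i (ty w xs) & adj w y != adj w (nth x0 xs i)].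
Proof.
move=> prG ux /andP[s1 sG].
have [/existsP[z /andP[zx ez]]|/existsPn noE] :=
  boolP [exists z, (z \notin xs) && extb (mx xs) (ty z xs)]; first by left; exists z.
right.
pose bad i y w := [&& y \notin xs, twinb (mx xs) i (ty y xs), w \notin xs,
  ~~ twinb (mx xs) i (ty w xs) & adj w y != adj w (nth x0 xs i)].
have [/existsP[i /existsP[y /existsP[w /and5P[*]]]]|noP] :=
  boolP [exists i : 'I_(size xs), exists y, exists w, bad i y w].
  by exists i, y, w.
have {}noP i y w : i < size xs -> bad i y w = false.
  move=> ix; apply: contraNF noP => H.
  by apply/existsP; exists (Ordinal ix); apply/existsP; exists y; apply/existsP; exists w.
have noT i z : i < size xs -> z \notin xs -> ~~ twinb (mx xs) i (ty z xs).
  move=> ix zx; apply/negP => tz.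
  pose Tw := [set y | (y == nth x0 xs i) || (y \notin xs) && twinb (mx xs) i (ty y xs)].
  have xiT : nth x0 xs i \in Tw by rewrite inE eqxx.
  have zT : z \in Tw by rewrite inE zx tz orbT.
  have mT : is_module Tw.
    move=> w wT.
    suff H y : y \in Tw -> adj w y = adj w (nth x0 xs i).
      by case E: (adj w (nth x0 xs i)) H => H; [left|right] => y /H ->.
    rewrite inE => /orP[/eqP->//|/andP[yx ty_]].
    move: wT; rewrite inE negb_or negb_and negbK => /andP[wi].
    have [wx _|wx /= wt] := boolP (w \in xs).
      by rewrite adj_sym (elimT (twinbP x0 y ux ix) ty_) // adj_sym.
    by have := noP i y w ix; rewrite /bad yx ty_ wx wt /= => /negbFE/eqP.
  (* [Tw] contains z and the i-th vertex but misses the j-th vertex chosen below, so it is a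
     nontrivial module. *)
  case: (prG _ mT) => [T0|[x Tx]|TT].
  - by rewrite T0 inE in zT.
  - move: xiT zT; rewrite Tx !inE => /eqP xix /eqP zE.
    by move: zx; rewrite zE -xix mem_nth.
  - pose j := if i == 0 then 1 else 0.
    have jx : j < size xs by rewrite /j; case: eqP; lia.
    have ji : j != i by rewrite /j; case: (i).
    have : nth x0 xs j \in Tw by rewrite TT inE.
    by rewrite inE nth_uniq // (negbTE ji) mem_nth.
(* With neither new types nor outside twins, every outside vertex is complete or anticomplete to
   [xs]. *)
have mX : is_module [set x in xs].
  move=> z; rewrite inE => zx; have := noE z; rewrite zx /= /extb.
  have -> : has (fun i => twinb (mx xs) i (ty z xs)) (iota 0 (size (mx xs))) = false.
    apply/hasPn => i; rewrite mem_iota add0n size_mx /= => ix; exact: noT.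
  rewrite andbT negb_and negbK => /orP[/hasPn H|/allP H]; [right|left] => y; rewrite inE => yx.
    by apply: H; rewrite map_f.
  by apply: H; rewrite map_f.
have cX : #|[set x in xs]| = size xs by rewrite cardsE; apply/card_uniqP.
case: (prG _ mX) => [X0|[x Xx]|XT].
- by rewrite X0 cards0 in cX; rewrite -cX in s1.
- by rewrite Xx cards1 in cX; rewrite -cX in s1.
- by rewrite XT cardsT in cX; rewrite cX ltnn in sG.
Qed.

(** * The search tree and its soundness *)

Section Search.
Variables (chk stop : seq (seq bool) -> bool) (N : nat).

(** [T] over-approximates the types of outside vertices. The bit prepended is the adjacency to the
    new vertex of type [s]. *)
Definition child_types s m (T : seq (seq bool)) : seq (seq bool) :=
  let m1 := ins s m in
  filter (fun t => chk (ins t m1)) (map (cons false) T ++ map (cons true) T).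

(** With [N] vertices the set may be all of the graph and need not extend, so the branch fails
    unless [stop] holds. In the second loop [b] is the adjacency of the second new vertex to the
    twin just added, and [nth false s' i] its adjacency to the i-th vertex; types satisfying [extb]
    are left to the first loop. *)
Fixpoint search fuel m (T : seq (seq bool)) : bool :=
  if fuel is f.+1 then
    if stop m then true else if N <= size m then false else
    if all (fun s => if extb m s then search f (ins s m) (child_types s m T) else true) T then
    all (fun i => all (fun s => if twinb m i s then
        let m1 := ins s m in let T1 := child_types s m T in
        all (fun w => if w is b :: s' then
            if [&& b != nth false s' i, ~~ twinb m i s' & ~~ extb m s'] then
              search f (ins w m1) (child_types w m1 T1) else true
          else true) T1
        else true) T) (iota 0 (size m))
    else false
  else false.

(* The rows of the initial graph are added one at a time, so that its list of
   types is filtered from the start. *)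
Fixpoint types n m : seq (seq bool) :=
  if n is n'.+1 then
    let m0 := map behead (behead m) in
    child_types (behead (head [::] m)) m0 (types n' m0)
  else [:: [::]].

Variables (G : sgraph) (P : Prop).
Hypothesis prG : prime_graph G.
Hypothesis NG : N <= #|G|.
Hypothesis chkP : forall xs : seq G, uniq xs -> chk (mx xs).
Hypothesis stopP : forall xs : seq G, uniq xs -> stop (mx xs) -> P.

Definition complete (T : seq (seq bool)) (xs : seq G) := forall z, z \notin xs -> ty z xs \in T.

Lemma complete_child T z xs : uniq (z :: xs) -> complete T xs ->
  complete (child_types (ty z xs) (mx xs) T) (z :: xs).
Proof.
move=> uzx cT z' z'zx; rewrite mem_filter -mx_cons -mx_cons chkP /=; last by rewrite z'zx.
have: ty z' xs \in T by apply: cT; apply: contra z'zx => z'x; rewrite inE z'x orbT.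
by rewrite mem_cat; case: (adj z' z) => H; rewrite (map_f (cons _)) ?orbT.
Qed.

Lemma search_sound fuel xs T : uniq xs -> 1 < size xs -> complete T xs ->
  search fuel (mx xs) T -> P.
Proof.
elim: fuel xs T => //= f IHf xs T ux s1 cT.
case: ifP => [sm _|_]; first exact: stopP sm.
rewrite size_mx; case: ltnP => // sN; case: ifP => // /allP extA /allP twA.
have [x0 _|x0] := pickP (mem [set: G]); last first.
  by case: xs s1 {ux cT sN extA twA} => // x xs; have := x0 x; rewrite !inE.
have [|[z zx ez]|[i [y [w [ix [yx ty_] wx tw wy]]]]] := prime_extension x0 prG ux.
- by rewrite s1 (leq_trans sN).
- have uzx : uniq (z :: xs) by rewrite /= zx.
  have := extA _ (cT _ zx); rewrite ez -mx_cons; apply: IHf => //=.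
    by rewrite ltnS ltnW.
  exact: complete_child.
have uyx : uniq (y :: xs) by rewrite /= yx.
(* If w has a new type over [xs], it is added alone and y is forgotten. *)
have [ew|new] := boolP (extb (mx xs) (ty w xs)).
  have uwx : uniq (w :: xs) by rewrite /= wx.
  have := extA _ (cT _ wx); rewrite ew -mx_cons; apply: IHf => //=.
    by rewrite ltnS ltnW.
  exact: complete_child.
have /twA : i \in iota 0 (size xs) by rewrite mem_iota.
move/allP/(_ _ (cT _ yx)); rewrite ty_ => /allP.
have wyx : w \notin y :: xs.
  by rewrite inE negb_or wx andbT; apply: contraNneq tw => ->.
have uwyx : uniq [:: w, y & xs] by rewrite /= -[(w \in _)]negbK wyx.
have cT1 := complete_child uyx cT.
move/(_ _ (cT1 _ wyx)) => /=.
rewrite (nth_map x0) // wy tw new /= -mx_cons -[_ :: _]/(ty w (y :: xs)) -mx_cons.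
by apply: IHf => //; exact: complete_child.
Qed.

Lemma typesP xs : uniq xs -> complete (types (size xs) (mx xs)) xs.
Proof.
elim: xs => [|x xs IHxs] //= /andP[xxs uxs].
rewrite -map_comp.
rewrite (_ : map _ _ = mx xs); last exact: eq_map.
by apply: complete_child; [rewrite /= xxs | exact: IHxs].
Qed.

End Search.

(** * Starting patterns and computed searches *)

Definition matrix_of (e : rel nat) n := [seq [seq e i j | j <- iota 0 n] | i <- iota 0 n].

Lemma mx_pat (G : sgraph) (xs : seq G) (e : rel nat) :
  code (@adj G) xs = code e (iota 0 (size xs)) ->
  symmetric e -> all (fun i => ~~ e i i) (iota 0 (size xs)) ->
  mx xs = matrix_of e (size xs).
Proof.
move=> cE es /allP er.
have [x0 _|x0] := pickP (mem [set: G]); last first.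
  by case: xs {cE er} => // x xs; have := x0 x; rewrite !inE.
apply: (@eq_from_nth _ [::]); rewrite ?size_map ?size_iota // => i ix.
apply: (@eq_from_nth _ false);
  rewrite !(nth_map x0) ?(nth_map 0) ?size_iota // ?size_map ?size_iota // => j jx.
rewrite (nth_map x0) // (nth_map 0) ?size_iota // !nth_iota // !add0n.
have main i' j' : i' < j' < size xs -> adj (nth x0 xs i') (nth x0 xs j') = e i' j'.
  move=> /andP[ij jx']; rewrite (@code_nth _ _ _ e x0 0 xs (iota 0 (size xs))) ?size_iota ?ij //.
  by rewrite !nth_iota //; apply: ltn_trans ij jx'.
case: (ltngtP i j) => [ij|ji|->]; first by rewrite main ?ij.
  by rewrite adj_sym es main ?ji.
by rewrite adj_irrefl; apply/esym/negbTE/er; rewrite mem_iota.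
Qed.

Definition undirected (l : seq (nat * nat)) : rel nat :=
  fun i j => ((i, j) \in l) || ((j, i) \in l).

Definition patP4 := undirected [:: (0, 1); (1, 2); (2, 3)].
(** The bundle with k = 3 and without y: the centre is 0, the u's are 1, 2, 3 and the v's are 4, 5,
    6. *)
Definition patS222 := undirected [:: (0, 1); (0, 2); (0, 3); (1, 4); (2, 5); (3, 6)].
(** The half graph: $a_i$ is i, $b_j$ is 3 + j, and they are adjacent exactly when i <= j. *)
Definition patHalf3 :=
  undirected [:: (0, 3); (0, 4); (0, 5); (1, 4); (1, 5); (2, 5)].

Definition run chk stop N fuel e n :=
  search chk stop N fuel (matrix_of e n) (types chk n (matrix_of e n)).

Lemma run_sound (chk stop : seq (seq bool) -> bool) N fuel (e : rel nat) n (G : sgraph) (P : Prop) :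
  prime_graph G -> N <= #|G| ->
  (forall xs : seq G, uniq xs -> chk (mx xs)) ->
  (forall xs : seq G, uniq xs -> stop (mx xs) -> P) ->
  symmetric e -> all (fun i => ~~ e i i) (iota 0 n) -> 1 < n ->
  run chk stop N fuel e n -> has_pat G e n -> P.
Proof.
move=> prG NG chkP stopP es er n1 R [ys uys [sys cE]].
have mE : mx ys = matrix_of e n by rewrite -sys; apply: mx_pat => //; rewrite sys.
apply: (search_sound prG NG chkP stopP uys _ _ (fuel := fuel)); first by rewrite sys.
  exact: typesP chkP _ uys.
by rewrite mE sys.
Qed.

Definition stop_pat e k m := find_pat m e (size m) k [::].
Definition pat_compl (e : rel nat) : rel nat := fun i j => (i != j) && ~~ e i j.
Definition stop_pat2 e k m :=
  if stop_pat e k m then true else stop_pat (pat_compl e) k m.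
Definition patBull6 :=
  undirected [:: (0, 1); (1, 2); (2, 3); (1, 4); (2, 4); (1, 5); (4, 5)].

(** The bound 10 is the order assumed of the graph. Each level adds at least one vertex, so fuel 6
    carries a search from five vertices up to ten. *)
Lemma run_P5 : run chk_sparse (stop_pat patS222 7) 10 6 patP5 5.
Proof. by vm_compute. Qed.

(* The six-vertex prime sparse extensions of the Bull are a graph and its
   complement up to isomorphism, so one search from 6 vertices covers them. *)
Lemma run_Bull : run chk_sparse (stop_pat2 patBull6 6) 10 6 patBull 5.
Proof. by vm_compute. Qed.

(** With [stop] constantly false, the search succeeds only if every branch dies out; this refutes
    the pattern in any large enough graph. *)
Lemma run_Bull6 : run chk_sparse (fun _ => false) 10 6 patBull6 6.
Proof. by vm_compute. Qed.

Lemma run_C5 : run (chk_avoid is_bad) (fun _ => false) 10 6 patC5 5.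
Proof. by vm_compute. Qed.

Lemma run_P4 : run (chk_avoid is_prime5) (stop_pat2 patHalf3 6) 10 6 patP4 4.
Proof. by vm_compute. Qed.

Lemma undirected_sym l : symmetric (undirected l).
Proof. by move=> i j; rewrite /undirected orbC. Qed.

Section Runs.
Variable G : sgraph.
Hypothesis prG : prime_graph G.
Hypothesis G10 : 10 <= #|G|.

Lemma has_pat_compl e n : symmetric e ->
  has_pat G (pat_compl e) n -> has_pat (complement G) e n.
Proof.
move=> es [ys uys [sys cE]]; exists ys => //; split=> //.
rewrite code_compl // cE; elim: (iota 0 n) (iota_uniq 0 n) => //= i s IHs /andP[ni us].
rewrite map_cat -map_comp IHs //; congr (_ ++ _).
apply/eq_in_map => j js /=; rewrite /pat_compl.
by case: eqP js ni => [->->//|_ _ _]; rewrite negbK.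
Qed.

Lemma stop_patP e k (xs : seq G) : uniq xs -> stop_pat e k (mx xs) -> has_pat G e k.
Proof. by move=> ux; rewrite /stop_pat size_mx; exact: find_pat_sound. Qed.

Lemma stop_pat2P e k (xs : seq G) : symmetric e -> uniq xs -> stop_pat2 e k (mx xs) ->
  has_pat G e k \/ has_pat (complement G) e k.
Proof.
move=> es ux; rewrite /stop_pat2; case: ifP => [/(stop_patP ux)|_ /(stop_patP ux)]; first by left.
by move/(has_pat_compl es); right.
Qed.

Lemma patP5_sym : symmetric patP5.
Proof. by move=> i j; rewrite /patP5 orbC. Qed.
Lemma patC5_sym : symmetric patC5.
Proof. by move=> i j; rewrite /patC5 orbC. Qed.
Lemma patBull_sym : symmetric patBull.
Proof. by move=> i j; rewrite /patBull orbC. Qed.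

Lemma sparse_P5 : sparse6 G -> has_pat G patP5 5 -> has_pat G patS222 7.
Proof.
move=> spG; apply: (run_sound prG G10 _ _ patP5_sym _ _ run_P5) => // xs ux.
  exact: chk_sparse_sound.
exact: stop_patP.
Qed.

Lemma sparse_Bull : sparse6 G -> has_pat G patBull 5 ->
  has_pat G patBull6 6 \/ has_pat (complement G) patBull6 6.
Proof.
move=> spG; apply: (run_sound prG G10 _ _ patBull_sym _ _ run_Bull) => // xs ux.
  exact: chk_sparse_sound.
by apply: stop_pat2P => //; exact: undirected_sym.
Qed.

Lemma sparse_Bull6 : sparse6 G -> ~ has_pat G patBull6 6.
Proof.
move=> spG; apply: (run_sound prG G10 _ _ (undirected_sym _) _ _ run_Bull6) => // xs ux.
exact: chk_sparse_sound.
Qed.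

Lemma avoid_C5 : avoids5 is_bad G -> ~ has_pat G patC5 5.
Proof.
move=> av; apply: (run_sound prG G10 _ _ patC5_sym _ _ run_C5) => // xs ux.
exact: chk_avoid_sound.
Qed.

Lemma avoid_P4 : avoids5 is_prime5 G -> has_pat G patP4 4 ->
  has_pat G patHalf3 6 \/ has_pat (complement G) patHalf3 6.
Proof.
move=> av; apply: (run_sound prG G10 _ _ (undirected_sym _) _ _ run_P4) => // xs ux.
  exact: chk_avoid_sound.
by apply: stop_pat2P => //; exact: undirected_sym.
Qed.

End Runs.

(** * Types over a fixed pattern *)

Lemma pat_types (G : sgraph) (chk : seq (seq bool) -> bool) (e : rel nat) n (ys : seq G) (z : G) :
  (forall xs : seq G, uniq xs -> chk (mx xs)) ->
  symmetric e -> all (fun i => ~~ e i i) (iota 0 n) ->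
  uniq ys -> size ys = n -> code (@adj G) ys = code e (iota 0 n) -> z \notin ys ->
  ty z ys \in types chk n (matrix_of e n).
Proof.
move=> chkP es er uys sys cE zys; rewrite -sys -(mx_pat (xs := ys)) ?sys // -sys.
exact: typesP chkP _ uys _ zys.
Qed.

(** By computation: sparsity leaves three of the 128 conceivable types. *)
Lemma S222_types (G : sgraph) (ys : seq G) (z : G) : sparse6 G ->
  uniq ys -> size ys = 7 -> code (@adj G) ys = code patS222 (iota 0 7) -> z \notin ys ->
  [\/ ty z ys = nseq 7 false, ty z ys = true :: nseq 6 false | ty z ys = nseq 7 true].
Proof.
move=> spG uys sys cE zys.
have := @pat_types G _ patS222 7 ys z (fun xs => @chk_sparse_sound G xs spG)
  (undirected_sym _) isT uys sys cE zys.
rewrite (_ : types _ _ _ = [:: nseq 7 false; true :: nseq 6 false; nseq 7 true]);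
  last by vm_compute.
by rewrite !inE => /or3P[] /eqP ->; [apply: Or31|apply: Or32|apply: Or33].
Qed.

(** * Graphs without induced P4 *)

Section Cograph.
Variable G : sgraph.

(** Makes the existence of a pattern decidable, so that proofs can split on it. *)
Lemma has_patP e n : reflect (has_pat G e n)
  [exists t : n.-tuple G, uniq t && (code (@adj G) t == code e (iota 0 n))].
Proof.
apply: (iffP existsP) => [[t /andP[ut /eqP ct]]|[ys uys [sys cE]]].
  by exists t => //; rewrite size_tuple.
have /eqP sys' := sys; exists (Tuple sys').
by rewrite /= uys cE eqxx.
Qed.

Definition splits (X Y : {set G}) (b : bool) :=
  [/\ Y \subset X, Y != set0, Y != X & forall x y, x \in Y -> y \in X -> y \notin Y -> adj x y = b].

(** P4 is self-complementary: for [b] true the edges are qs, sp and pr, forming the path q s p r.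
    Vertices told apart by a third one are distinct. *)
Lemma P4_of (b : bool) (p q r s : G) :
  adj p q = ~~ b -> adj q r = ~~ b -> adj r s = ~~ b ->
  adj p r = b -> adj q s = b -> adj p s = b -> has_pat G patP4 4.
Proof.
move=> pq qr rs pr qs ps.
have ne (z x y : G) : adj z x != adj z y -> x != y by apply: contraNneq => ->.
have U : uniq [:: p; q; r; s].
  rewrite /= !inE !negb_or !andbT -!andbA; apply/and5P; split; last (apply/andP; split).
  - by apply: (ne r); rewrite adj_sym pr adj_sym qr; case: (b).
  - by apply: (ne s); rewrite adj_sym ps adj_sym rs; case: (b).
  - by apply: (ne q); rewrite adj_sym pq qs; case: (b).
  - by apply: (ne s); rewrite adj_sym qs adj_sym rs; case: (b).
  - by apply: (ne p); rewrite pq ps; case: (b).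
  - by apply: (ne q); rewrite qr qs; case: (b).
case: b pq qr rs pr qs ps => /= pq qr rs pr qs ps.
  exists [:: q; s; p; r].
  move: U; rewrite /= !inE !negb_or !andbT -!andbA.
    by rewrite (eq_sym q p) (eq_sym s p) (eq_sym s r) => /and5P[-> -> -> -> /andP[-> ->]].
  by split=> //=; rewrite qs qr pr ![adj s _]adj_sym ?[adj q p]adj_sym pq ps rs.
by exists [:: p; q; r; s] => //; split=> //=; rewrite pq qr rs pr qs ps.
Qed.

(** The vertices of [Y1] related to [v] by [b] split [X]: if such an x were related by [~~ b] to a y
    in the rest of [Y1], then x, y, v, d2 would induce a P4, along edges or non-edges according to
    [b]. *)
Lemma split_aux (X Y1 Y2 : {set G}) v b d1 d2 c : ~ has_pat G patP4 4 ->
  X = v |: (Y1 :|: Y2) -> v \notin Y1 -> v \notin Y2 -> [disjoint Y1 & Y2] ->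
  (forall x y, x \in Y1 -> y \in Y2 -> adj x y = b) ->
  d1 \in Y1 -> adj v d1 = ~~ b -> d2 \in Y2 -> adj v d2 = ~~ b ->
  c \in Y1 -> adj v c = b -> exists Y b', splits X Y b'.
Proof.
move=> noP4 XE v1 v2 dj cross d1Y a1 d2Y a2 cY ac.
exists [set x in Y1 | adj v x == b], b; split.
- by apply/subsetP => x; rewrite XE !inE => /andP[-> _]; rewrite orbT.
- by apply/set0Pn; exists c; rewrite inE cY ac eqxx.
- by apply/eqP => /setP/(_ v); rewrite XE !inE eqxx (negbTE v1).
move=> x y; rewrite XE !inE => /andP[x1 /eqP vx] /or3P[/eqP->|y1|y2] yn.
- by rewrite adj_sym.
- apply/eqP; apply: contraT => xy; exfalso; apply: noP4.
  move: yn; rewrite y1 /= => vy.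
  have xy' : adj x y = ~~ b by move: xy; case: (adj x y); case: (b).
  have vy' : adj v y = ~~ b by move: vy; case: (adj v y); case: (b).
  have [yv' xv'] : adj y v = ~~ b /\ adj x v = b by rewrite ![adj _ v]adj_sym.
  exact: (@P4_of b x y v d2 xy' yv' a2 xv' (cross _ _ y1 d2Y) (cross _ _ x1 d2Y)).
- exact: cross.
Qed.

(* Seinsche's theorem; [b] tells whether the two parts are complete or
   anticomplete to each other, so that complements are handled at once. *)
Lemma cograph_split (X : {set G}) : ~ has_pat G patP4 4 -> 1 < #|X| ->
  exists Y b, splits X Y b.
Proof.
move=> noP4; move: {2}#|X| (leqnn #|X|) => n.
elim: n X => [|n IHn] X; first by lia.
move=> Xn X1.
have [v vX] : exists v, v \in X by apply/set0Pn; rewrite -card_gt0; lia.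
have cX' : #|X| = #|X :\ v|.+1 by rewrite (cardsD1 v) vX.
have [X'1|X'1] := leqP #|X :\ v| 1.
  have /eqP/cards1P[w Xw] : #|X :\ v| = 1 by lia.
  exists [set v], (adj v w); split.
  - by rewrite sub1set.
  - by rewrite -card_gt0 cards1.
  - by apply/eqP => XE; rewrite -XE cards1 in X1.
  - move=> x y; rewrite !inE => /eqP -> yX yv.
    by have : y \in X :\ v by [rewrite !inE yv]; rewrite Xw inE => /eqP ->.
(* Split the rest into [Y] and [Z] by induction, then put v back. *)
have [|Y [b [YX Y0 YnX cross]]] := IHn _ _ X'1; first by lia.
pose Z := (X :\ v) :\: Y.
have vY : v \notin Y by apply/negP => /(subsetP YX); rewrite !inE eqxx.
have vZ : v \notin Z by rewrite !inE eqxx andbF.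
have XE : X = v |: (Y :|: Z).
  apply/setP => x; rewrite !inE; case: eqP => [->|/eqP xv] //=.
  case: (boolP (x \in Y)) => //= /(subsetP YX); by rewrite !inE => /andP[].
have XE' : X = v |: (Z :|: Y) by rewrite setUC [Z :|: _]setUC setUC.
have Z0 : Z != set0.
  by apply: contraNneq YnX => /eqP; rewrite setD_eq0 => ZY; rewrite eqEsubset YX.
have cr x y : x \in Y -> y \in Z -> adj x y = b.
  by move=> xY; rewrite inE => /andP[yY yX]; exact: cross.
have cr' x y : x \in Z -> y \in Y -> adj x y = b by move=> xZ yY; rewrite adj_sym cr.
have dj : [disjoint Y & Z] by rewrite -setI_eq0; apply/eqP/setP => x; rewrite !inE; case: (x \in Y).
have dj' : [disjoint Z & Y] by rewrite disjoint_sym.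
(* A part to which v is related by [b] throughout already splits [X]. *)
have side A B : X = v |: (A :|: B) -> A != set0 -> v \notin A ->
    (forall x y, x \in A -> y \in B -> adj x y = b) ->
    (exists2 d, d \in A & adj v d = ~~ b) \/ exists Y b', splits X Y b'.
  move=> E A0 vA crA; have [/existsP[d /andP[dA /eqP vd]]|/existsPn H] :=
    boolP [exists d, (d \in A) && (adj v d == ~~ b)]; first by left; exists d.
  right; exists A, b; split=> //.
  - by rewrite E subsetU // subsetUl orbT.
  - by apply: contraNneq vA => ->.
  move=> x y xA; rewrite E !inE => /or3P[/eqP-> _|->//|yB _]; last exact: crA.
  by have := H x; rewrite xA adj_sym; case: (adj x v); case: (b).
have [[d1 d1Y a1]|//] := side Y Z XE Y0 vY cr.
have [[d2 d2Z a2]|//] := side Z Y XE' Z0 vZ cr'.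
have [/existsP[c /and3P[cX cv /eqP ac]]|/existsPn H] :=
  boolP [exists c, [&& c \in X, c != v & adj v c == b]].
  have : c \in v |: (Y :|: Z) by rewrite -XE.
  rewrite !in_setU in_set1 (negbTE cv) /= => /orP[cY|cZ].
    exact: (split_aux noP4 XE vY vZ dj cr d1Y a1 d2Z a2 cY ac).
  apply: (split_aux noP4 XE' vZ vY dj' cr' d2Z a2 d1Y a1 cZ ac).
(* Here v is related to all the rest by [~~ b]. *)
exists [set v], (~~ b); split.
- by rewrite sub1set.
- by rewrite -card_gt0 cards1.
- by apply/eqP => XE1; rewrite -XE1 cards1 in X1.
- move=> x y; rewrite !inE => /eqP -> yX yv.
  by have := H y; rewrite yX yv /=; case: (adj _ _); case: (b).
Qed.

(** A split of the vertex set consists of two complementary modules; by primality each has one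
    element, leaving only two vertices. *)
Lemma prime_P4 : prime_graph G -> 2 < #|G| -> has_pat G patP4 4.
Proof.
move=> prG G3; apply/has_patP; apply: contraT => /has_patP noP4.
have [|Y [b [_ Y0 YT cr]]] := @cograph_split [set: G] noP4; first by rewrite cardsT; lia.
have card1 (Z : {set G}) : is_module Z -> Z != set0 -> Z != [set: G] -> #|Z| = 1.
  by move=> /prG[->|[x ->] _ _|->]; rewrite ?cards1 ?eqxx.
have mY : is_module Y.
  move=> x xY; case: (b) cr => cr; [left|right] => y yY; by rewrite adj_sym cr ?inE.
have mZ : is_module (~: Y).
  move=> x; rewrite inE negbK => xY.
  by case: (b) cr => cr; [left|right] => y; rewrite inE => yY; rewrite cr ?inE.
have := cardsC Y; rewrite (card1 _ mY) // (card1 _ mZ).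
- by rewrite -[Defs.vertex _]/(_) => E; move: G3; rewrite -E.
- by apply: contraNneq YT => /(congr1 (@setC _)); rewrite setCK setC0 => ->.
- by apply: contraNneq Y0 => /(congr1 (@setC _)); rewrite setCK setCT => ->.
Qed.

End Cograph.

(** Total functions on [nat] are easily modified and extended; the first vertex of the copy is the
    default value, hence [0 < n]. *)
Lemma has_pat_fun (G : sgraph) e n : symmetric e -> all (fun i => ~~ e i i) (iota 0 n) ->
  0 < n -> has_pat G e n ->
  exists f : nat -> G, forall i j, i < n -> j < n -> adj (f i) (f j) = e i j.
Proof.
move=> es ei n0 [[|x0 ys] uys [sys cE]]; first by rewrite -sys in n0.
exists (nth x0 (x0 :: ys)) => i j id jd.
rewrite -mgetE ?sys // (mx_pat (e := e)) ?sys // /mget.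
by rewrite (nth_map 0) ?size_iota // (nth_map 0) ?size_iota // !nth_iota.
Qed.

(** * Maximal bundles in sparse prime graphs *)

Section Bundle.
Variable G : sgraph.
Hypothesis prG : prime_graph G.
Hypothesis spG : sparse6 G.

(** A bundle without y. Distinctness of its vertices is not imposed: the adjacencies force it once
    [2 < k]. *)
Definition spider k (x : G) (u v : nat -> G) :=
  (forall i, i < k -> adj x (u i) /\ adj x (v i) = false) /\
  (forall i j, i < k -> j < k -> [/\ adj (u i) (u j) = false,
     adj (u i) (v j) = (i == j) & adj (v i) (v j) = false]).

Section Spider.
Variables (k : nat) (x : G) (u v : nat -> G).
Hypothesis k3 : 2 < k.
Hypothesis S : spider k x u v.

Let xu i : i < k -> adj x (u i). Proof. by case: S => H _ /H[]. Qed.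
Let xv i : i < k -> adj x (v i) = false. Proof. by case: S => H _ /H[]. Qed.
Let uu i j : i < k -> j < k -> adj (u i) (u j) = false.
Proof. by case: S => _ H ik jk; case: (H i j ik jk). Qed.
Let uv i j : i < k -> j < k -> adj (u i) (v j) = (i == j).
Proof. by case: S => _ H ik jk; case: (H i j ik jk). Qed.
Let vv i j : i < k -> j < k -> adj (v i) (v j) = false.
Proof. by case: S => _ H ik jk; case: (H i j ik jk). Qed.

Lemma spider_ux i : i < k -> u i != x.
Proof. by move=> ik; apply: contraTneq (xu ik) => ->; rewrite adj_irrefl. Qed.

Lemma spider_vx i : i < k -> v i != x.
Proof.
move=> ik; apply/eqP => E.
(* An index other than i: its u is adjacent to x but not to [v i]. *)
have jk : (if i == 0 then 1 else 0) < k by case: eqP; lia.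
have := xu jk; rewrite -E adj_sym uv //.
by case: (i) => [|i'].
Qed.

Lemma spider_uv i j : i < k -> j < k -> u i != v j.
Proof.
by move=> ik jk; apply: contraTneq (xu ik) => ->; rewrite xv.
Qed.

Lemma spider_uinj i j : i < k -> j < k -> (u i == u j) = (i == j).
Proof.
move=> ik jk; apply/eqP/eqP => [E|-> //]; apply/eqP.
by rewrite -(uv ik jk) E uv.
Qed.

Lemma spider_vinj i j : i < k -> j < k -> (v i == v j) = (i == j).
Proof.
move=> ik jk; apply/eqP/eqP => [E|-> //]; apply/eqP.
by rewrite -(uv ik jk) -E uv.
Qed.

Definition in_spider := [set z | (z == x) ||
  [exists i : 'I_k, (z == u i) || (z == v i)]].

Lemma in_spiderP z : reflect (z = x \/ exists2 i, i < k & z = u i \/ z = v i)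
  (z \in in_spider).
Proof.
rewrite inE; apply: (iffP orP) => -[H|H].
- by left; apply/eqP.
- right; by case/existsP: H => i /orP[]/eqP->; exists (i : nat); rewrite ?ltn_ord; auto.
- by left; apply/eqP.
- right; case: H => i ik H; apply/existsP; exists (Ordinal ik).
  by case: H => ->; rewrite eqxx ?orbT.
Qed.

Lemma spider_class3 i j l z : z \notin in_spider -> i < k -> j < k -> l < k ->
  uniq [:: i; j; l] ->
  [\/ ty z [:: x; u i; u j; u l; v i; v j; v l] = nseq 7 false,
      ty z [:: x; u i; u j; u l; v i; v j; v l] = true :: nseq 6 false |
      ty z [:: x; u i; u j; u l; v i; v j; v l] = nseq 7 true].
Proof.
move=> zS ik jk lk uijl.
have [ij il jl] : [/\ i != j, i != l & j != l].
  by move: uijl; rewrite /= !inE negb_or andbT => /andP[/andP[]].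
apply: S222_types => //.
- rewrite /= !inE !negb_or !spider_uinj // !spider_vinj // !spider_uv //.
  by rewrite ![x == _]eq_sym !spider_ux // !spider_vx // ij il jl.
- rewrite /= !xu // !xv // !uu // !vv // !uv // !eqxx ![_ == i]eq_sym ![l == _]eq_sym.
  by rewrite (negbTE ij) (negbTE il) (negbTE jl).
- apply: contra zS; rewrite 7!inE => H; apply/in_spiderP.
  case/orP: H => [/eqP->|]; first by left.
  by move=> H; right; case/or4P: H => [/eqP->|/eqP->|/eqP->|/or3P[]/eqP->];
    [exists i|exists j|exists l|exists i|exists j|exists l]; auto.
Qed.

(** Every index lies in one of the triples 0, 1, i or 0, 1, 2, and the three types over a triple of
    legs make z uniform on its u's and v's. *)
Lemma spider_class z i : z \notin in_spider -> i < k ->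
  [/\ adj z (u i) = adj z (u 0), adj z (v i) = adj z (u 0) & adj z (u 0) -> adj z x].
Proof.
move=> zS ik; case: (ltnP 1 i) => i1.
  have := spider_class3 zS (_ : 0 < k) (_ : 1 < k) ik.
  rewrite /= !inE negb_or !andbT /= (ltn_eqF (ltnW i1)) (ltn_eqF i1).
  by case=> //; try lia; case=> -> -> _ -> _ _ ->.
have := spider_class3 zS (_ : 0 < k) (_ : 1 < k) k3.
case=> //; try lia; move: i1 ik; case: i => [|[|i]] // _ _;
  by case=> h1 h2 h3 _ h5 h6 _; rewrite ?h1 ?h2 ?h3 ?h5 ?h6.
Qed.

Lemma spider_card : k <= #|G|.
Proof.
rewrite -[k]card_ord; apply: (@leq_card _ _ (fun i : 'I_k => v i)) => i j /eqP.
by rewrite spider_vinj // => /eqP/val_inj.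
Qed.

(** By [spider_class] such a vertex sees only x in the spider. It is a candidate for y, or for the u
    of a new leg. *)
Definition spider_leaf z := [&& z \notin in_spider, adj z x & ~~ adj z (u 0)].

Lemma spider_leafP z i : spider_leaf z -> i < k ->
  [/\ adj z x, adj z (u i) = false & adj z (v i) = false].
Proof.
case/and3P => zS zx zu ik; case: (spider_class zS ik) => -> -> _.
by rewrite zx (negbTE zu).
Qed.

Lemma spider_extend z w : spider_leaf z -> w \notin in_spider -> adj w x = false ->
  adj w (u 0) = false -> adj z w ->
  spider k.+1 x (fun i => if i == k then z else u i) (fun i => if i == k then w else v i).
Proof.
move=> zL wS wx wu zw.
have wc i : i < k -> adj w (u i) = false /\ adj w (v i) = false.
  by move=> /(spider_class wS)[-> -> _].
split=> [i|i j]; rewrite !ltnS leq_eqVlt.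
  case: eqP => [_ _|_ ik /=]; last by rewrite xu ?xv.
  by rewrite ![adj x _]adj_sym wx; case/and3P: zL.
rewrite (leq_eqVlt j); case: eqP => [->|_] /=; case: eqP => [->|_] //=.
- by move=> _ _; rewrite !adj_irrefl zw eqxx.
- move=> _ jk; have [_ zu zv] := spider_leafP zL jk; have [wu' wv] := wc j jk.
  by rewrite zu zv wv gtn_eqF.
- move=> ik _; have [_ zu zv] := spider_leafP zL ik; have [wu' wv] := wc i ik.
  by rewrite adj_sym zu adj_sym wu' adj_sym wv ltn_eqF.
by move=> ik jk; rewrite uu // uv // vv.
Qed.

(* Otherwise z x v1 u2 t and z x v1 u3 t would be two Bulls. *)
Lemma spider_leaf_total z t : spider_leaf z -> t \notin in_spider -> adj t (u 0) ->
  adj t z.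
Proof.
move=> zL tS tu; apply: contraT => /negbTE tz.
have [k0 k1] : 0 < k /\ 1 < k by lia.
have [[zx zu0 zv0] [_ zu1 zv1]] := (spider_leafP zL k0, spider_leafP zL k1).
have [_ zu2 _] := spider_leafP zL k3.
have [tu1 tv1 tx] := spider_class tS k1.
have [tu2 tv2 _] := spider_class tS k3; have [_ tv0 _] := spider_class tS k0.
rewrite tu in tu1 tv1 tx tu2 tv2 tv0; have {}tx := tx isT.
have zS : z \notin in_spider by case/and3P: zL.
have memS y : y \in in_spider -> (t != y) /\ (z != y).
  by move=> yS; split; [apply: contraNneq tS|apply: contraNneq zS] => ->.
have [tx' zx'] := memS x (introT (in_spiderP _) (or_introl erefl)).
have inu i : i < k -> u i \in in_spider by move=> ik; apply/in_spiderP; right; exists i; auto.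
have inv i : i < k -> v i \in in_spider by move=> ik; apply/in_spiderP; right; exists i; auto.
have [tu1' zu1'] := memS _ (inu _ k1); have [tu2' zu2'] := memS _ (inu _ k3).
have [tv0' zv0'] := memS _ (inv _ k0).
have ztn : z != t by apply: contraTneq tu => <-; rewrite zu0.
have := spG (_ : uniq [:: z; x; t; v 0; u 1; u 2]) erefl.
rewrite /= !inE !negb_or zx' ztn zv0' zu1' zu2' [t == _]eq_sym ![x == _]eq_sym tx'.
rewrite !spider_vx // !spider_ux // ![v 0 == _]eq_sym !spider_uv // spider_uinj //.
rewrite tv0' tu1' tu2' /= => /(_ isT).
rewrite zx [adj z t]adj_sym tz zv0 zu1 zu2 [adj x t]adj_sym tx !xu // xv // tv0 tu1 tu2.
rewrite [adj (v 0) (u 1)]adj_sym [adj (v 0) (u 2)]adj_sym !uv // uu //.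
Qed.

End Spider.

(** Induction on the number of legs that may still be added. When none can be, the spider and its
    leaves form a module, hence everything; the leaves are then themselves a module missing x, so
    there is at most one. *)
Lemma spider_bundle k x u v : 2 < k -> spider k x u v -> P5_bundle G.
Proof.
have [n] := ubnP (#|G|.+1 - k).
elim: n k x u v => // n IHn k x u v kn k3 S.
have kG := spider_card S.
have [/existsP[z /existsP[w /and5P[zL wS wx wu zw]]]|/existsPn noE] :=
  boolP [exists z, exists w, [&& spider_leaf k x u v z, w \notin in_spider k x u v,
    ~~ adj w x, ~~ adj w (u 0) & adj z w]].
  apply: (IHn k.+1); last exact: (spider_extend k3 S zL wS (negbTE wx) (negbTE wu) zw).
  - by lia.
  - by lia.
have k0 : 0 < k by lia.
have k1 : 1 < k by lia.
have xS : x \in in_spider k x u v by apply/in_spiderP; left.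
have uS i : i < k -> u i \in in_spider k x u v.
  by move=> ik; apply/in_spiderP; right; exists i; auto.
have vS i : i < k -> v i \in in_spider k x u v.
  by move=> ik; apply/in_spiderP; right; exists i; auto.
pose L := [set z | spider_leaf k x u v z].
have mM : is_module (in_spider k x u v :|: L).
  move=> w; rewrite !inE -[(w == x) || _]/(_) negb_or => /andP[].
  have <- : (w \in in_spider k x u v) = (w == x) || [exists i : 'I_k, (w == u i) || (w == v i)].
    by rewrite inE.
  move=> wS; rewrite /spider_leaf wS /= negb_and negbK => wL.
  have wc i := spider_class k3 S wS (i := i).
  (* A neighbour of [u 0] is complete to the spider and its leaves; any other w is anticomplete to
     them, because no leg can be added. *)
  have [wu|/negbTE wu] := boolP (adj w (u 0)).
    left=> y /setUP[/in_spiderP[->|[i ik [->|->]]]|].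
    + by case: (wc 0 k0) => _ _; exact.
    + by case: (wc i ik) => ->.
    + by case: (wc i ik) => _ ->.
    + by rewrite inE => yL; exact: (spider_leaf_total k3 S yL wS wu).
  rewrite wu orbF in wL.
  right=> y /setUP[/in_spiderP[->//|[i ik [->|->]]]|].
  + by case: (wc i ik) => ->; rewrite wu.
  + by case: (wc i ik) => _ ->; rewrite wu.
  + rewrite inE => yL; have /existsPn/(_ w) := noE y.
    by rewrite yL wS wL wu /= adj_sym.
have MT : in_spider k x u v :|: L = [set: G].
  case: (prG mM) => [M0|[y My]|//].
    by have := in_set0 x; rewrite -M0 inE xS.
  have ux := spider_ux S k0.
  have : x \in [set y] by rewrite -My inE xS.
  have : u 0 \in [set y] by rewrite -My inE uS.
  by rewrite !inE => /eqP <- /eqP E; rewrite E eqxx in ux.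
have inSL z : z \notin in_spider k x u v -> z \in L.
  by move=> zS; have := in_setT z; rewrite -MT inE (negbTE zS).
have mL : is_module L.
  move=> w wL; have : w \in in_spider k x u v by apply: contraNT wL; exact: inSL.
  case/in_spiderP => [->|[i ik [->|->]]]; [left|right|right] => y; rewrite inE => yL;
    rewrite adj_sym; first by case/and3P: yL.
  - by case: (spider_leafP k3 S yL ik) => _ ->.
  - by case: (spider_leafP k3 S yL ik) => _ _ ->.
(* [b] records whether there is a leaf. If there is none, y defaults to x, which is harmless because
   ['I_b] is then empty. *)
have [b [y [Lb Ly]]] : exists (b : bool) y, L = (if b then [set y] else set0) /\ (b -> y \in L).
  case: (prG mL) => [->|[y ->]|LT].
  - by exists false, x.
  - by exists true, y; rewrite inE.
  - by have := in_setT x; rewrite -LT inE /spider_leaf xS.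
exists k, b; split; first by lia.
pose g (p : bundle_graph k b) : G := match p with
  | inl (inl _) => x | inl (inr _) => y
  | inr (inl i) => u i | inr (inr i) => v i end.
have yn (i : 'I_b) : y \notin in_spider k x u v.
  have : y \in L by apply: Ly; case: (b) i => // -[].
  by rewrite inE => /and3P[].
have yc (i : 'I_b) j : j < k -> [/\ adj y x, adj y (u j) = false & adj y (v j) = false].
  have yL : y \in L by apply: Ly; case: (b) i => // -[].
  by move: yL; rewrite inE => yL jk; exact: (spider_leafP k3 S yL).
have gE p q : adj (g p) (g q) = adj p q.
  case: (S) => S1 S2; rewrite /= /rel_adj.
  have eqI (i j : 'I_k) : (i == j :> nat) = (i == j) by [].
  case: p => [[[]|i]|[i|i]]; case: q => [[[]|j]|[j|j]] /=;
    rewrite ?adj_irrefl ?andbF ?orbF ?andbT //=.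
  - by rewrite adj_sym; case: (yc j 0 k0).
  - by case: (S1 j (ltn_ord j)).
  - by case: (S1 j (ltn_ord j)).
  - by case: (yc i 0 k0).
  - by case: (yc i j (ltn_ord j)).
  - by case: (yc i j (ltn_ord j)).
  - by rewrite adj_sym; case: (S1 i (ltn_ord i)).
  - by rewrite adj_sym; case: (yc j i (ltn_ord i)).
  - by case: (S2 i j (ltn_ord i) (ltn_ord j)).
  - by case: (S2 i j (ltn_ord i) (ltn_ord j)).
  - by rewrite adj_sym; case: (S1 i (ltn_ord i)).
  - by rewrite adj_sym; case: (yc j i (ltn_ord i)).
  - by rewrite adj_sym; case: (S2 j i (ltn_ord j) (ltn_ord i)).
  - by case: (S2 i j (ltn_ord i) (ltn_ord j)).
have gI : injective g.
  have bI (i j : 'I_b) : i = j.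
    by apply: val_inj; case: (b) i j => -[i Hi] [j Hj] //=; lia.
  have inS (p : bundle_graph k b) :
      (if p is inl (inr _) then False else True) -> g p \in in_spider k x u v.
    by case: p => [[[]|i]|[i|i]] //= _; auto.
  case=> [[[]|i]|[i|i]]; case=> [[[]|j]|[j|j]] //= E;
    try (by rewrite (bI i j)).
  all: try (by move: (yn j); rewrite -E ?xS ?uS ?vS).
  all: try (by move: (yn i); rewrite E ?xS ?uS ?vS).
  all: try (by have := spider_ux S (ltn_ord i); rewrite E eqxx).
  all: try (by have := spider_ux S (ltn_ord j); rewrite -E eqxx).
  all: try (by have := spider_vx k3 S (ltn_ord i); rewrite E eqxx).
  all: try (by have := spider_vx k3 S (ltn_ord j); rewrite -E eqxx).
  all: try (by have := spider_uv S (ltn_ord i) (ltn_ord j); rewrite E eqxx).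
  all: try (by have := spider_uv S (ltn_ord j) (ltn_ord i); rewrite E eqxx).
  + by move/eqP: E; rewrite (spider_uinj S) // => /eqP/val_inj ->.
  + by move/eqP: E; rewrite (spider_vinj S) // => /eqP/val_inj ->.
have gS z : exists p, g p = z.
  have [|/inSL] := boolP (z \in in_spider k x u v).
    case/in_spiderP => [->|[i ik [->|->]]].
    - by exists (inl (inl tt)).
    - by exists (inr (inl (Ordinal ik))).
    - by exists (inr (inr (Ordinal ik))).
  move=> zL; have bT : b = true.
    by apply: contraTT zL => /negbTE bF; rewrite Lb bF inE.
  have /eqP -> : z == y by move: zL; rewrite Lb bT inE.
  have b0 : 0 < b by rewrite bT.
  by exists (inl (inr (Ordinal b0))).
have /fin_all_exists[f fK] := gS.
have gK : cancel g f by move=> p; apply: gI; rewrite fK.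
exists f; first by exists g.
by move=> z w; rewrite -gE !fK.
Qed.

Lemma S222_bundle : has_pat G patS222 7 -> P5_bundle G.
Proof.
case/(has_pat_fun (undirected_sym _)) => // f fE.
apply: (@spider_bundle 3 (f 0) (fun i => f (1 + i)) (fun i => f (4 + i))) => //.
split=> [i i3|i j i3 j3]; rewrite !fE //; try lia.
  by case: i i3 => [|[|[|i]]].
by case: i j i3 j3 => [|[|[|i]]] [|[|[|j]]].
Qed.

End Bundle.

(** * Half graphs and the types over them *)

Definition half3_types : seq (seq bool) := Eval vm_compute in
  types (chk_avoid is_prime5) 6 (matrix_of patHalf3 6).

(** Bits are grouped into pairs of adjacencies to $a_i$ and $b_i$: a type over a half graph becomes
    a word over four letters whose three-letter subwords are constrained. *)
Definition half3_word (p q r : bool * bool) :=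
  [:: p.1; q.1; r.1; p.2; q.2; r.2] \in half3_types.

Section HalfGraph.
Variable G : sgraph.
Hypothesis prG : prime_graph G.
Hypothesis frG : avoids5 is_prime5 G.

Definition half k (a b : nat -> G) := forall i j, i < k -> j < k ->
  [/\ adj (a i) (b j) = (i <= j), adj (a i) (a j) = false & adj (b i) (b j) = false].

Definition half_set k (a b : nat -> G) :=
  [set z | [exists i : 'I_k, (z == a i) || (z == b i)]].

(** Twins of [a i] over the half graph; as in [twinb], the adjacency to [a i] itself is free. *)
Definition likeA k (a b : nat -> G) z i :=
  [forall l : 'I_k, (adj z (b l) == (i <= l)) && ((l != i :> nat) ==> ~~ adj z (a l))].

Definition likeB k (a b : nat -> G) z i :=
  [forall l : 'I_k, (adj z (a l) == (l <= i)) && ((l != i :> nat) ==> ~~ adj z (b l))].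

Lemma half_setP k a b z :
  reflect (exists2 i, i < k & z = a i \/ z = b i) (z \in half_set k a b).
Proof.
rewrite inE; apply: (iffP existsP) => [[i /orP[]/eqP->]|[i ik H]].
- by exists (i : nat); rewrite ?ltn_ord; auto.
- by exists (i : nat); rewrite ?ltn_ord; auto.
by exists (Ordinal ik); case: H => ->; rewrite eqxx ?orbT.
Qed.

Lemma likeAP k a b z i : reflect (forall l, l < k ->
    adj z (b l) = (i <= l) /\ (l != i -> adj z (a l) = false)) (likeA k a b z i).
Proof.
apply: (iffP forallP) => [H l lk|H l].
  have /andP[/eqP -> /implyP E] := H (Ordinal lk); split=> // li.
  exact/negbTE/E.
have [-> E] := H l (ltn_ord l); rewrite eqxx /=; apply/implyP => /E -> //.
Qed.

Lemma likeBP k a b z i : reflect (forall l, l < k ->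
    adj z (a l) = (l <= i) /\ (l != i -> adj z (b l) = false)) (likeB k a b z i).
Proof.
apply: (iffP forallP) => [H l lk|H l].
  have /andP[/eqP -> /implyP E] := H (Ordinal lk); split=> // li.
  exact/negbTE/E.
have [-> E] := H l (ltn_ord l); rewrite eqxx /=; apply/implyP => /E -> //.
Qed.

Section Fixed.
Variables (k : nat) (a b : nat -> G).
Hypothesis k3 : 2 < k.
Hypothesis S : half k a b.

Let ab i j : i < k -> j < k -> adj (a i) (b j) = (i <= j).
Proof. by move=> ik jk; case: (S ik jk). Qed.
Let aa i j : i < k -> j < k -> adj (a i) (a j) = false.
Proof. by move=> ik jk; case: (S ik jk). Qed.
Let bb i j : i < k -> j < k -> adj (b i) (b j) = false.
Proof. by move=> ik jk; case: (S ik jk). Qed.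

Lemma half_a_neq i j : i < k -> j < k -> (a i == a j) = (i == j).
Proof.
move=> ik jk; apply/eqP/eqP => [E|-> //].
have := ab ik ik; have := ab jk jk; rewrite -{1}E (ab ik jk) leqnn => ij.
by rewrite E ab // leqnn => ji; lia.
Qed.

Lemma half_b_neq i j : i < k -> j < k -> (b i == b j) = (i == j).
Proof.
move=> ik jk; apply/eqP/eqP => [E|-> //].
have := ab ik ik; have := ab jk jk; rewrite -{1}E (ab jk ik) leqnn => ij.
by rewrite E ab // leqnn => ji; lia.
Qed.

Lemma half_ab_neq i j : i < k -> j < k -> a i != b j.
Proof.
move=> ik jk; apply/eqP => E.
by have := ab ik ik; rewrite leqnn E bb.
Qed.

Lemma half_word i j l z : z \notin half_set k a b -> i < j < l -> l < k ->
  half3_word (adj z (a i), adj z (b i)) (adj z (a j), adj z (b j)) (adj z (a l), adj z (b l)).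
Proof.
move=> zS /andP[ij jl] lk; have jk := ltn_trans jl lk; have ik := ltn_trans ij jk.
have il := ltn_trans ij jl.
rewrite /half3_word; pose ys := [:: a i; a j; a l; b i; b j; b l].
have := @pat_types G _ patHalf3 6 ys z (fun xs => @chk_avoid_sound _ G xs frG)
  (undirected_sym _) isT.
rewrite (_ : types _ _ _ = half3_types); last by vm_compute.
apply=> //.
- rewrite /= !inE !negb_or !half_a_neq // !half_b_neq // !half_ab_neq //.
  by rewrite !ltn_eqF.
- rewrite /= !ab // !aa // !bb // !leqnn ![_ <= i]leqNgt [l <= j]leqNgt.
  by rewrite ij il jl (ltnW ij) (ltnW il) (ltnW jl).
- apply: contra zS; rewrite !inE => H; apply/existsP.
  case/or4P: H => [/eqP->|/eqP->|/eqP->|/or3P[]/eqP->];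
  [exists (Ordinal ik)|exists (Ordinal jk)|exists (Ordinal lk)
  |exists (Ordinal ik)|exists (Ordinal jk)|exists (Ordinal lk)]; by rewrite eqxx ?orbT.
Qed.

Definition uniform z c := forall l, l < k -> adj z (a l) = c /\ adj z (b l) = c.

Lemma likeA_a i : i < k -> likeA k a b (a i) i.
Proof. by move=> ik; apply/likeAP => l lk; rewrite ab // aa. Qed.

Lemma likeB_b i : i < k -> likeB k a b (b i) i.
Proof. by move=> ik; apply/likeBP => l lk; rewrite adj_sym ab // bb. Qed.

(** The l-th letter of the word of z is its pair of adjacencies to $a_l$ and $b_l$. Twins of $a_i$
    have letter 00 before i and 01 after it; twins of $b_i$ have 10 before i and 00 after it. The
    first and last letters settle most cases; in the other two, i comes from the first position
    where the initial letter is left. *)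
Lemma half_class z : [\/ uniform z false, uniform z true,
  (exists2 i, i < k & likeA k a b z i) | (exists2 i, i < k & likeB k a b z i)].
Proof.
have [/half_setP[i ik [->|->]]|zS] := boolP (z \in half_set k a b).
- by apply: Or43; exists i => //; exact: likeA_a.
- by apply: Or44; exists i => //; exact: likeB_b.
have W := half_word zS.
have mid l : 0 < l < k.-1 -> half3_word (adj z (a 0), adj z (b 0))
    (adj z (a l), adj z (b l)) (adj z (a k.-1), adj z (b k.-1)).
  by move=> lk; apply: W; lia.
have tri l : l < k -> [\/ l = 0, l = k.-1 | 0 < l < k.-1].
  move=> lk; case: (eqVneq l 0) => [->|l0]; first by apply: Or31.
  by case: (eqVneq l k.-1) => [->|l1]; [apply: Or32|apply: Or33; lia].
have lastk : k.-1 < k by lia.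
have mid1 := mid 1 ltac:(lia).
case A0: (adj z (a 0)) mid mid1 W; case B0: (adj z (b 0));
  case Al: (adj z (a k.-1)); case Bl: (adj z (b k.-1)) => mid mid1 W.
(* The letter at 1, strictly between the ends, rules out all other pairs of end letters. *)
all: try (by exfalso; move: mid1; case: (adj z (a 1)); case: (adj z (b 1))).
all: have k0 : 0 < k by lia.
all: have cases (Q : nat -> bool -> bool -> Prop) :
    Q 0 (adj z (a 0)) (adj z (b 0)) -> Q k.-1 (adj z (a k.-1)) (adj z (b k.-1)) ->
    (forall l, 0 < l < k.-1 -> Q l (adj z (a l)) (adj z (b l))) ->
    forall l, l < k -> Q l (adj z (a l)) (adj z (b l))
  by move=> Q0 Q1 Qm l /tri[->|->|/Qm].
all: rewrite A0 B0 Al Bl in cases.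
all: clear tri mid1.
- by apply: Or42; apply: (cases (fun _ p q => p = true /\ q = true)) => // l /mid;
    case: (adj z (a l)); case: (adj z (b l)).
- apply: Or43; exists 0 => //; apply/likeAP.
  apply: (cases (fun l p q => q = (0 <= l) /\ (l != 0 -> p = false))) => // l /mid.
  by case: (adj z (a l)); case: (adj z (b l)).
- apply: Or44; exists 0 => //; apply/likeBP.
  apply: (cases (fun l p q => p = (l <= 0) /\ (l != 0 -> q = false))) => //.
    by split => //; lia.
  move=> l lm; move/mid: (lm); case: (adj z (a l)); case: (adj z (b l)) => // _; split=> //; lia.
- apply: Or44; exists k.-1 => //; apply/likeBP.
  apply: (cases (fun l p q => p = (l <= k.-1) /\ (l != k.-1 -> q = false))) => //.
    by split; lia.
  move=> l lm; move/mid: (lm); case: (adj z (a l)); case: (adj z (b l)) => // _; split=> //; lia.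
- apply: Or44; exists k.-1 => //; apply/likeBP.
  apply: (cases (fun l p q => p = (l <= k.-1) /\ (l != k.-1 -> q = false))) => //.
    by split; lia.
  move=> l lm; move/mid: (lm); case: (adj z (a l)); case: (adj z (b l)) => // _; split=> //; lia.
(* The word starts with 10 and ends with 00; i will be the first position whose letter is not 10. *)
- have exi : exists i, (i < k) && ((adj z (a i), adj z (b i)) != (true, false)).
    by exists k.-1; rewrite Al Bl lastk.
  case: (ex_minnP exi) => i /andP[ik ni] mini.
  have i0 : 0 < i by case: i ni {ik mini} => //; rewrite A0 B0.
  have lo l : l < i -> adj z (a l) = true /\ adj z (b l) = false.
    move=> li; have : ~~ (i <= l) by rewrite -ltnNge.
    by move/(contra (mini l)); rewrite (ltn_trans li ik) negbK => /eqP[-> ->].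
  have hi l : i < l < k -> adj z (a l) = false /\ adj z (b l) = false.
    case/andP=> il lk; have := W 0 i l; rewrite i0 il => /(_ isT lk); move: ni; rewrite A0 B0.
    case: (adj z (a i)); case: (adj z (b i)); case: (adj z (a l)); case: (adj z (b l)) => //.
  have [ai bi] : adj z (a i) = adj z (b i) /\ True.
    split=> //; move: ni; case: (ltnP i k.-1) => ik1.
      by have := mid i; rewrite i0 ik1 => /(_ isT); case: (adj z (a i)); case: (adj z (b i)).
    by have -> : i = k.-1 by [lia]; rewrite Al Bl.
  (* The letter at i is 00 or 11: in the first case z is a twin of $b_{i-1}$, in the second of
     $b_i$. *)
  apply: Or44; case E: (adj z (b i)); last first.
    exists i.-1; first by lia.
    apply/likeBP => l lk; case: (ltngtP l i) => [li|il|->].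
    + by have [-> ->] := lo l li; split=> //; lia.
    + by have [-> ->] := hi l ltac:(lia); split=> //; lia.
    + by rewrite ai E; split=> //; lia.
  exists i => //; apply/likeBP => l lk; case: (ltngtP l i) => [li|il|->].
  + by have [-> ->] := lo l li; split=> //; lia.
  + by have [-> ->] := hi l ltac:(lia); split=> //; lia.
  + by rewrite ai E; split=> //; lia.
- apply: Or43; exists 0 => //; apply/likeAP.
  apply: (cases (fun l p q => q = (0 <= l) /\ (l != 0 -> p = false))) => // l /mid.
  by case: (adj z (a l)); case: (adj z (b l)).
- apply: Or43; exists k.-1 => //; apply/likeAP.
  apply: (cases (fun l p q => q = (k.-1 <= l) /\ (l != k.-1 -> p = false))) => //.
  + by split=> //; lia.
  + by split; lia.
  move=> l lm; move/mid: (lm); case: (adj z (a l)); case: (adj z (b l)) => // _; split=> //; lia.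
- have exi : exists i, (i < k) && ((adj z (a i), adj z (b i)) != (false, false)).
    by exists k.-1; rewrite Al Bl lastk.
  case: (ex_minnP exi) => i /andP[ik ni] mini.
  have i0 : 0 < i by case: i ni {ik mini} => //; rewrite A0 B0.
  have lo l : l < i -> adj z (a l) = false /\ adj z (b l) = false.
    move=> li; have : ~~ (i <= l) by rewrite -ltnNge.
    by move/(contra (mini l)); rewrite (ltn_trans li ik) negbK => /eqP[-> ->].
  have hi l : i < l < k -> adj z (a l) = false /\ adj z (b l) = true.
    case/andP=> il lk; have := W 0 i l; rewrite i0 il => /(_ isT lk).
    move: ni; case: (ltnP i k.-1) => ik1; last by lia.
    have := mid i; rewrite i0 ik1 => /(_ isT); rewrite A0 B0.
    by case: (adj z (a i)); case: (adj z (b i)); case: (adj z (a l)); case: (adj z (b l)).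
  have bi : adj z (b i) = true.
    move: ni; case: (ltnP i k.-1) => ik1.
      by have := mid i; rewrite i0 ik1 => /(_ isT); case: (adj z (a i)); case: (adj z (b i)).
    by have -> : i = k.-1 by [lia]; rewrite Al Bl.
  apply: Or43; exists i => //; apply/likeAP => l lk; case: (ltngtP l i) => [li|il|->].
  + by have [-> ->] := lo l li; split=> //; lia.
  + by have [-> ->] := hi l ltac:(lia); split=> //; lia.
  + by rewrite bi; split=> //; lia.
- by apply: Or41; apply: (cases (fun _ p q => p = false /\ q = false)) => // l /mid;
    case: (adj z (a l)); case: (adj z (b l)).
Qed.

End Fixed.

(** * Enlarging half graphs *)

Definition insert p (y : G) (a : nat -> G) l :=
  if l < p then a l else if l == p then y else a l.-1.

Lemma half_insert k a b p y w : half k a b -> p <= k -> adj y w ->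
  (forall l, l < k -> [/\ adj y (b l) = (p <= l), adj y (a l) = false,
                          adj w (a l) = (l < p) & adj w (b l) = false]) ->
  half k.+1 (insert p y a) (insert p w b).
Proof.
move=> S pk yw H.
have Hl i : i < k.+1 -> [\/ i < p /\ i < k, i = p | p < i /\ i.-1 < k].
  move=> ik; case: (ltngtP i p) => ip; [apply: Or31|apply: Or33|exact: Or32]; split=> //; lia.
move=> i j ik jk; rewrite /insert.
have [[ip ik']|->|[ip ik']] := Hl i ik; have [[jp jk']|->|[jp jk']] := Hl j jk;
  rewrite ?ltnn ?eqxx ?ip ?jp ?(gtn_eqF ip) ?(gtn_eqF jp)
  ?(ltnNge i) ?(ltnNge j) ?(ltnW ip) ?(ltnW jp) /=.
- exact: S.
- by have [H1 H2 H3 H4] := H i ik';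
    rewrite [adj _ w]adj_sym [adj _ y]adj_sym [adj _ w]adj_sym H2 H3 H4; split=> //; lia.
- by have [-> -> ->] := S i j.-1 ik' jk'; split=> //; lia.
- by have [H1 H2 H3 H4] := H j jk'; rewrite H1 H2 H4; split=> //; lia.
- by rewrite yw !adj_irrefl leqnn.
- by have [H1 H2 H3 H4] := H j.-1 jk'; rewrite H1 H2 H4; split=> //; lia.
- by have [-> -> ->] := S i.-1 j ik' jk'; split=> //; lia.
- by have [H1 H2 H3 H4] := H i.-1 ik';
    rewrite [adj _ w]adj_sym [adj _ y]adj_sym [adj _ w]adj_sym H2 H3 H4; split=> //; lia.
- by have [-> -> ->] := S i.-1 j.-1 ik' jk'; split=> //; lia.
Qed.

Definition grows k := exists a b, half k.+1 a b.

Lemma half_replace k a b i y : half k a b -> i < k -> likeA k a b y i ->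
  half k (fun l => if l == i then y else a l) b.
Proof.
move=> S ik /likeAP yA l j lk jk; have [ab aa bb] := S l j lk jk; split=> //.
  by case: eqP => [->|_] //; case: (yA j jk).
case: eqP => [El|/eqP li]; case: eqP => [Ej|/eqP ji] //.
- by rewrite adj_irrefl.
- by case: (yA j jk) => _; apply.
- by rewrite adj_sym; case: (yA l lk) => _; apply.
Qed.

(** Classifying w over the half graph and over the one where y replaces [a i] leaves one
    possibility: in the half graph, w sees exactly the $a_l$ with l < i. Then y and w form a new
    pair to be inserted at position i, provided y is not adjacent to [a i]. *)
Lemma half_grow_aux k a b i y w : 2 < k -> half k a b -> i < k ->
  likeA k a b y i -> ~~ likeA k a b w i -> adj w y -> adj w (a i) = false -> grows k.
Proof.
move=> k3 S ik yA wA wy wai.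
have S' := half_replace S ik yA; set a' := fun l => _ in S'.
have a'E l : l != i -> a' l = a l by rewrite /a' => /negbTE ->.
have a'i : a' i = y by rewrite /a' eqxx.
have yA' := elimT (likeAP _ _ _ _ _) yA.
have wc l : l < k -> adj w (a l) = (l < i) /\ adj w (b l) = false.
  have [wO|wT|[j jk wj]|[j jk wj]] := half_class k3 S w.
  - have [O'|T'|[j jk wj]|[j jk wj]] := half_class k3 S' w.
    + by have := O' i ik; rewrite a'i wy => -[].
    + by have := T' i ik; have := wO i ik => -[_ ->] [].
    + by have := elimT (likeAP _ _ _ _ _) wj j jk => -[]; have [_ ->] := wO j jk; rewrite leqnn.
    + have wj' := elimT (likeBP _ _ _ _ _) wj.
      have ij : i <= j by have := wj' i ik; rewrite a'i wy => -[].
      have [i0|i0] := eqVneq i 0; first by rewrite i0 => /wO[-> ->].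
      have := wj' 0 ltac:(lia); rewrite a'E ?(eq_sym 0) // => -[].
      by have [-> _] := wO 0 ltac:(lia).
  - by have := wT i ik; rewrite wai => -[].
  - have wjA := elimT (likeAP _ _ _ _ _) wj.
    have ji : j != i by apply: contraNneq wA => <-.
    have [O'|T'|[m mk wm]|[m mk wm]] := half_class k3 S' w.
    + by have := O' i ik; rewrite a'i wy => -[].
    + have [n [nk ni nj]] : exists n, [/\ n < k, n != i & n != j].
        case: (ltngtP i j) ji => // ij _;
        by (case: (eqVneq (minn i j) 0) => ?;
          [case: (eqVneq (maxn i j) 1) => ?; [exists 2|exists 1]|exists 0]); split; lia.
      have := T' n nk; rewrite a'E // => -[wan _].
      by have [_ /(_ nj)] := wjA n nk; rewrite wan.
    + have wm' := elimT (likeAP _ _ _ _ _) wm.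
      have jm : m = j.
        have [E1 _] := wm' m mk; have [E2 _] := wjA m mk.
        have [E3 _] := wm' j jk; have [E4 _] := wjA j jk.
        by move: E1 E3; rewrite E2 E4 !leqnn => ? /esym ?; lia.
      have [_] := wm' i ik; rewrite jm eq_sym => /(_ ji); by rewrite a'i wy.
    + have wm' := elimT (likeBP _ _ _ _ _) wm.
      have jl : j = k.-1 /\ m = k.-1.
        have kl : k.-1 < k by lia.
        have jE : m = k.-1.
          apply/eqP; apply: contraT => mk'; have [_] := wm' _ kl.
          rewrite eq_sym => /(_ mk'); have [-> _] := wjA _ kl; lia.
        split=> //; apply/eqP; apply: contraT => jk'.
        have jm : j != m by rewrite jE.
        by have [_ /(_ jm)] := wm' j jk; have [-> _] := wjA j jk; rewrite leqnn.
      have [n [nk ni nj]] : exists n, [/\ n < k, n != i & n != j].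
        by case: (eqVneq i 0) => ?; [exists 1|exists 0]; split; lia.
      have [E _] := wm' n nk; rewrite a'E // in E.
      by have [_ /(_ nj)] := wjA n nk; rewrite E; lia.
  - have wj' := elimT (likeBP _ _ _ _ _) wj.
    have ji : j < i by have [E _] := wj' i ik; move: E; rewrite wai; lia.
    have [O'|T'|[m mk wm]|[m mk wm]] := half_class k3 S' w.
    + by have := O' i ik; rewrite a'i wy => -[].
    + have ij : i != j by lia.
      by have [_ /(_ ij)] := wj' i ik; have [_ ->] := T' i ik.
    + have [E _] := elimT (likeAP _ _ _ _ _) wm k.-1 ltac:(lia).
      have jl : k.-1 != j by lia.
      by have [_ /(_ jl)] := wj' k.-1 ltac:(lia); rewrite E; lia.
    + have wm' := elimT (likeBP _ _ _ _ _) wm.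
      have im : i <= m by have [E _] := wm' i ik; move: E; rewrite a'i wy.
      (* Over the first half graph w is a twin of $b_j$, over the second of $b_m$, with j < i <= m.
         An index strictly between j and i would tell these two apart. *)
      have Ei : i = j.+1.
        apply/eqP; apply: contraT => ij; have jk1 : j.+1 < k by lia.
        have [E _] := wm' j.+1 jk1; have [E' _] := wj' j.+1 jk1.
        by rewrite a'E in E; [move: E'; rewrite E; lia | lia].
      move=> lk; have [-> E1] := wj' l lk; split; first by rewrite Ei.
      have [lj|] := eqVneq l j; last exact: E1.
      by have [_] := wm' l lk; apply; lia.
have ya l : l < k -> adj y (a l) = false.
  move=> lk; have [->|li] := eqVneq l i; last by case: (yA' l lk) => _; exact.
  apply/negbTE/negP => yai.
  have yb l' : l' < k -> adj y (b l') = (i <= l') by move=> /yA'[].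
  have wb l' : l' < k -> adj w (b l') = false by move=> /wc[].
  have ab l1 l2 : l1 < k -> l2 < k -> adj (a l1) (b l2) = (l1 <= l2).
    by move=> h1 h2; case: (S l1 l2 h1 h2).
  have aa l1 l2 : l1 < k -> l2 < k -> adj (a l1) (a l2) = false.
    by move=> h1 h2; case: (S l1 l2 h1 h2).
  (* Distinct rows of the matrix guarantee that the vertices are distinct. *)
  have no5 m (zs : seq G) : mx zs = m -> size m = 5 -> uniq m ->
      ~~ is_prime5 (code (mget m) (iota 0 5)).
    move=> <- ; rewrite size_mx => sz /map_uniq uz.
    rewrite (code_mget w) ?sz // -sz map_nth_iota0 // take_size.
    exact: frG.
  have sy (z z' : G) c : adj z z' = c -> adj z' z = c by rewrite adj_sym.
  have wai' := sy _ _ _ wai; have yw := sy _ _ _ wy; have ayi := sy _ _ _ yai.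
  have wbi := wb _ ik; have bwi := sy _ _ _ wbi.
  have ybi := yb _ ik; have byi := sy _ _ _ ybi.
  have abi := ab _ _ ik ik; have bai := sy _ _ _ abi.
  rewrite leqnn in ybi byi abi bai.
  have [il|il] := ltnP i.+1 k.
    have [waj wbj] := wc _ il; have ybj := yb _ il; have abj := ab _ _ ik il.
    have aaj := aa _ _ ik il; have abjj := ab _ _ il il.
    have yaj : adj y (a i.+1) = false by have [_] := yA' _ il; apply; rewrite gtn_eqF.
    rewrite ltnNge leqnSn /= in waj; rewrite leqnSn in ybj abj; rewrite leqnn in abjj.
    (* A Bull: the triangle y, $a_i$, $b_{i+1}$ with pendant vertices w and $a_{i+1}$. *)
    suff /no5/(_ erefl isT) : mx [:: w; y; a i; b i.+1; a i.+1] =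
        [:: [:: false; true; false; false; false];
            [:: true; false; true; true; false];
            [:: false; true; false; true; false];
            [:: false; true; true; false; true];
            [:: false; false; false; true; false]] by [].
    by rewrite /mx /= !adj_irrefl wy wai wai' wbj waj yw yai ayi ybj yaj abj aaj abjj
      (sy _ _ _ wbj) (sy _ _ _ waj) (sy _ _ _ ybj) (sy _ _ _ yaj) (sy _ _ _ abj) (sy _ _ _ aaj)
      (sy _ _ _ abjj).
  have i0 : 0 < i by apply: ltnW; rewrite -ltnS; exact: leq_trans k3 il.
  have k0 : 0 < k by exact: leq_ltn_trans ik.
  have [waj wbj] := wc _ k0; have aaj := aa _ _ ik k0; have abj := ab _ _ k0 ik.
  have yaj : adj y (a 0) = false by have [_] := yA' _ k0; apply; rewrite ltn_eqF.
  rewrite i0 in waj; rewrite leq0n in abj.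
  (* Here i is the last index. The 4-cycle w, y, $b_i$, $a_0$ and the vertex $a_i$, adjacent to y
     and $b_i$, form a co-P5. *)
  suff /no5/(_ erefl isT) : mx [:: w; y; a i; b i; a 0] =
        [:: [:: false; true; false; false; true];
            [:: true; false; true; true; false];
            [:: false; true; false; true; false];
            [:: false; true; true; false; true];
            [:: true; false; false; true; false]] by [].
  by rewrite /mx /= !adj_irrefl wy wai wai' wbi bwi waj yw yai ayi ybi byi yaj abi bai aaj abj
    (sy _ _ _ waj) (sy _ _ _ yaj) (sy _ _ _ aaj) (sy _ _ _ abj).
exists (insert i y a), (insert i w b); apply: half_insert => //; first exact: ltnW.
  by rewrite adj_sym.
by move=> l lk; have [-> ->] := wc l lk; have [-> _] := yA' l lk; rewrite ya.
Qed.

(** Up to symmetry w sees y1 and misses y2; putting y2 in the place of [a i] reduces this to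
    [half_grow_aux]. *)
Lemma half_grow k a b i y1 y2 w : 2 < k -> half k a b -> i < k ->
  likeA k a b y1 i -> likeA k a b y2 i -> ~~ likeA k a b w i ->
  adj w y1 != adj w y2 -> grows k.
Proof.
move=> k3 S ik.
wlog [wy1 wy2] : y1 y2 / adj w y1 /\ adj w y2 = false.
  move=> H A1 A2 wA; case E1: (adj w y1); case E2: (adj w y2) => // _.
    by apply: (H y1 y2) => //; rewrite E1 E2.
  by apply: (H y2 y1) => //; rewrite E1 E2.
move=> A1 A2 wA _; have S' := half_replace S ik A2.
have like z : likeA k (fun l => if l == i then y2 else a l) b z i = likeA k a b z i.
  apply: eq_forallb => l; congr (_ && _).
  by case: eqP => // -> ; rewrite eqxx.
apply: (half_grow_aux k3 S' ik (y := y1) (w := w)) => //; rewrite ?like //.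
by rewrite eqxx.
Qed.

Lemma likeA_module k a b i : 2 < k -> half k a b -> i < k ->
  is_module [set z | likeA k a b z i] \/ grows k.
Proof.
move=> k3 S ik.
pose Q w y := [&& likeA k a b y i, ~~ likeA k a b w i & adj w y != adj w (a i)].
have [/existsP[w /existsP[y /and3P[yA wA wy]]]|/existsPn noQ] :=
  boolP [exists w, exists y, Q w y].
  by right; apply: (half_grow k3 S ik yA (likeA_a S ik) wA wy).
left=> w; rewrite inE => wA.
have E y : likeA k a b y i -> adj w y = adj w (a i).
  by move=> yA; have /existsPn/(_ y) := noQ w; rewrite /Q yA wA /= negbK => /eqP.
by case W: (adj w (a i)); [left|right] => y; rewrite inE => /E ->; rewrite W.
Qed.

(** Reversing the order exchanges the two sides, so that results on twins of $a_i$ transfer to twins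
    of $b_i$. *)
Lemma half_rev k a b : half k a b -> half k (fun l => b (k.-1 - l)) (fun l => a (k.-1 - l)).
Proof.
move=> S i j ik jk; have ri : k.-1 - i < k by lia.
have rj : k.-1 - j < k by lia.
rewrite adj_sym; have [-> _ _] := S _ _ rj ri.
have [_ -> ->] := S _ _ ri rj.
by split=> //; lia.
Qed.

Lemma likeB_rev k a b z i : i < k ->
  likeA k (fun l => b (k.-1 - l)) (fun l => a (k.-1 - l)) z (k.-1 - i) = likeB k a b z i.
Proof.
move=> ik; apply/likeAP/likeBP => H l lk; have rl : k.-1 - l < k by lia.
  have lK : k.-1 - (k.-1 - l) = l by lia.
  have [] := H _ rl; rewrite lK => -> E.
  by split; [lia | move=> li; apply: E; lia].
by have [-> E] := H _ rl; split; [lia | move=> li; apply: E; lia].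
Qed.

Lemma likeB_module k a b i : 2 < k -> half k a b -> i < k ->
  is_module [set z | likeB k a b z i] \/ grows k.
Proof.
move=> k3 S ik; have ri : k.-1 - i < k by lia.
have [M|] := likeA_module k3 (half_rev S) ri; last by right.
left; rewrite (_ : [set _ | _] = [set z |
  likeA k (fun l => b (k.-1 - l)) (fun l => a (k.-1 - l)) z (k.-1 - i)]) //.
by apply/setP => z; rewrite !inE likeB_rev.
Qed.

Lemma half_card k a b : 2 < k -> half k a b -> k <= #|G|.
Proof.
move=> k3 S; rewrite -[k]card_ord; apply: (@leq_card _ _ (fun i : 'I_k => a i)) => i j /eqP.
by rewrite (half_a_neq k3 S) // => /eqP/val_inj.
Qed.

Lemma forall_or (P : nat -> Prop) (Q : Prop) k :
  (forall i, i < k -> P i \/ Q) -> (forall i, i < k -> P i) \/ Q.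
Proof.
elim: k => [|k IHk] H; first by left.
have [HP|] := IHk (fun i ik => H i (ltnW ik)); last by right.
have [Pk|] := H k (ltnSn k); last by right.
by left=> i; rewrite ltnS leq_eqVlt => /orP[/eqP->|/HP].
Qed.

Lemma module_eq (M : {set G}) z y z' : is_module M -> z \in M -> y \in M ->
  z' \notin M -> y = z.
Proof.
move=> /prG[->|[x ->]|->]; rewrite !inE //.
by move=> /eqP-> /eqP->.
Qed.

(** Induction on the room left for k. If the half graph cannot grow, its twin classes are modules,
    hence singletons; outside vertices are then uniform, so the half graph is a module and thus
    everything. *)
Lemma half_bipartite k a b : 2 < k -> half k a b -> bipartite G.
Proof.
have [n] := ubnP (#|G|.+1 - k).
elim: n k a b => // n IHn k a b kn k3 S.
have kG := half_card k3 S.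
have growP : grows k -> bipartite G.
  by case=> a' [b' S']; apply: (IHn k.+1 a' b') => //; lia.
have [mA|] := @forall_or (fun i => is_module [set z | likeA k a b z i]) (grows k) k
  (fun i ik => likeA_module k3 S ik); last exact: growP.
have [mB|] := @forall_or (fun i => is_module [set z | likeB k a b z i]) (grows k) k
  (fun i ik => likeB_module k3 S ik); last exact: growP.
have [k0 k1] : 0 < k /\ 1 < k by lia.
have aS i : i < k -> a i \in half_set k a b by move=> ik; apply/half_setP; exists i; auto.
have bS i : i < k -> b i \in half_set k a b by move=> ik; apply/half_setP; exists i; auto.
have other i : i < k -> exists2 j, j < k & j != i.
  by case: i => [|i] _; [exists 1|exists 0].
have uni z : z \notin half_set k a b -> uniform k a b z false \/ uniform k a b z true.
  move=> zS; have [|||] := half_class k3 S z; auto.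
    case=> i ik zA; have [j jk ji] := other i ik; case/negP: zS.
    (* Otherwise $a_i$ and $a_j$ would agree on both $b_i$ and $b_j$, forcing i = j. *)
    suff jA : a j \notin [set y | likeA k a b y i].
      rewrite (_ : z = a i) ?aS //.
      by apply: (module_eq (mA i ik) _ _ jA); rewrite inE ?likeA_a.
    rewrite inE; apply/negP => /likeAP H; have [E1 _] := H i ik; have [E2 _] := H j jk.
    have [E3 _ _] := S j i jk ik; have [E4 _ _] := S j j jk jk.
    by move: E1 E2; rewrite E3 E4; lia.
  case=> i ik zB; have [j jk ji] := other i ik; case/negP: zS.
  suff jB : b j \notin [set y | likeB k a b y i].
    rewrite (_ : z = b i) ?bS //.
    by apply: (module_eq (mB i ik) _ _ jB); rewrite inE ?likeB_b.
  rewrite inE; apply/negP => /likeBP H; have [E1 _] := H i ik; have [E2 _] := H j jk.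
  have [E3 _ _] := S i j ik jk; have [E4 _ _] := S j j jk jk.
  by move: E1 E2; rewrite ![adj (b j) _]adj_sym E3 E4; lia.
have mH : is_module (half_set k a b).
  by move=> z /uni[] U; [right|left] => y /half_setP[i ik [->|->]];
    case: (U i ik) => E1 E2; rewrite ?E1 ?E2.
have allH z : z \in half_set k a b.
  apply: contraT => zS; have := module_eq mH (aS 0 k0) (bS 0 k0) zS.
  by move/eqP; rewrite eq_sym (negbTE (half_ab_neq S k0 k0)).
have aA i : i < k -> a i \in [set z | [exists i : 'I_k, z == a i]].
  by move=> ik; rewrite inE; apply/existsP; exists (Ordinal ik).
have bA i : i < k -> b i \notin [set z | [exists i : 'I_k, z == a i]].
  move=> ik; rewrite inE; apply/existsPn => j.
  by rewrite eq_sym (half_ab_neq S).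
exists [set z | [exists i : 'I_k, z == a i]] => x y.
case/half_setP: (allH x) => i ik [->|->]; case/half_setP: (allH y) => j jk [->|->].
- by case: (S i j ik jk) => _ ->.
- by rewrite aA // (negbTE (bA j jk)).
- by rewrite aA // (negbTE (bA i ik)).
- by case: (S i j ik jk) => _ _ ->.
Qed.

End HalfGraph.

Lemma Half3_bipartite (G : sgraph) : prime_graph G -> avoids5 is_prime5 G ->
  has_pat G patHalf3 6 -> bipartite G.
Proof.
move=> prG frG; case/(has_pat_fun (undirected_sym _)) => // f fE.
apply: (@half_bipartite G prG frG 3 f (fun i => f (3 + i))) => // i j i3 j3.
rewrite !fE //; try lia.
by case: i j i3 j3 => [|[|[|i]]] [|[|[|j]]].
Qed.

(** * Assembling the cases *)

Lemma avoids5_P5_free (G : sgraph) : avoids5 is_bad G -> P5_free G.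
Proof.
move=> av A iso.
have [ys uys [sys cE]] := @iso_has_pat G A P5 id patP5 (@inj_id 'I_5) P5_patE iso.
by have := av ys uys sys; rewrite cE; apply/negP.
Qed.

(** A graph and its complement have the same modules. *)
Lemma prime_compl (G : sgraph) : prime_graph G -> prime_graph (complement G).
Proof.
move=> prG M mM; apply: prG => x xM; have [H|H] := mM x xM; [right|left] => y yM.
  by have /andP[] := H y yM.
have := H y yM; rewrite /= /compl_adj negb_and !negbK => /orP[/eqP E|//].
by rewrite E yM in xM.
Qed.

(** Listing the vertices along the inverse of [p] brings the pattern back to its standard order. *)
Lemma perm_has_pat (G : sgraph) e n (ys : seq G) p :
  symmetric e -> all (fun i => ~~ e i i) (iota 0 n) -> uniq ys -> size ys = n ->
  p \in permutations (iota 0 n) -> code (@adj G) ys = code e p -> has_pat G e n.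
Proof.
move=> es /allP ei uys sys; rewrite mem_permutations => pp cE.
have sp : size p = n by rewrite (perm_size pp) size_iota.
case: (pickP (mem [set: G])) => [x0 _|noG]; last first.
  exists ys => //; split=> //; case: ys uys sys cE => [|y ys]; last by have := noG y; rewrite !inE.
  by move=> _ <-.
have pE i : i < n -> i \in p by move=> i_n; rewrite (perm_mem pp) mem_iota.
have ixl i : i < n -> index i p < n by move=> /pE; rewrite -index_mem sp.
exists (map (fun i => nth x0 ys (index i p)) (iota 0 n)).
  rewrite map_inj_in_uniq ?iota_uniq // => i j; rewrite !mem_iota /= add0n => i_n j_n /eqP.
  rewrite nth_uniq ?sys ?ixl // => /eqP E.
  by rewrite -[i](nth_index 0 (pE _ i_n)) E nth_index ?pE.
rewrite size_map size_iota; split=> //; rewrite code_map; apply: eq_in_code => i j.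
rewrite !mem_iota /= !add0n => i_n j_n.
have main i' j' : i' < n -> j' < n -> index i' p < index j' p ->
    adj (nth x0 ys (index i' p)) (nth x0 ys (index j' p)) = e i' j'.
  move=> i'n j'n ij; rewrite (code_nth x0 0 _ cE) ?sp ?sys // ?nth_index ?pE //.
  by rewrite ij ixl.
case: (ltngtP (index i p) (index j p)) => [ij|ji|E]; first exact: main.
  by rewrite adj_sym es main.
have -> : i = j by rewrite -[i](nth_index 0 (pE _ i_n)) E nth_index ?pE.
by rewrite adj_irrefl; apply/esym/negbTE/ei; rewrite mem_iota.
Qed.

Section Main.
Variable G : sgraph.
Hypothesis prG : prime_graph G.
Hypothesis G10 : 10 <= #|G|.

Let prG' : prime_graph (complement G) := prime_compl prG.
Let G10' : 10 <= #|complement G| := G10.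

Lemma avoids_bad_bipartite : avoids5 is_bad G ->
  exists2 H : sgraph, H = G \/ H = complement G & P5_free H /\ bipartite H.
Proof.
move=> av; have noC5 := avoid_C5 prG G10 av.
(* Among the prime graphs on five vertices, only $C_5$ was left to exclude. *)
have fr : avoids5 is_prime5 G.
  move=> ys uys sys; rewrite is_prime5E ?size_code ?sys // negb_or av //=.
  apply/mapP => -[p pp cE]; apply: noC5.
  exact: perm_has_pat patC5_sym _ uys sys pp cE.
have av' : avoids5 is_bad (complement G) by exact: avoids5_compl is_bad_compl av.
have fr' : avoids5 is_prime5 (complement G) by exact: avoids5_compl is_prime5_compl fr.
have [|Hf|Hf] := avoid_P4 prG G10 fr; first by apply: prime_P4 => //; exact: leq_trans G10.
  exists G; first by left.
  by split; [exact: avoids5_P5_free | exact: Half3_bipartite].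
exists (complement G); first by right.
by split; [exact: avoids5_P5_free | exact: Half3_bipartite].
Qed.

End Main.

Theorem mainTheorem4 (G : sgraph) :
  prime_graph G -> P5_coP5_Bull_sparse G ->
  exists2 H : sgraph, H = G \/ H = complement G &
    [\/ isomorphic H C5, P5_free H /\ bipartite H, P5_bundle H | #|H| < 10].
Proof.
move=> prG /sparse_sparse6 spG.
have [G9|G10] := ltnP #|G| 10; first by exists G; [left | apply: Or44].
have spG' := sparse6_compl spG; have prG' := prime_compl prG.
have G10' : 10 <= #|complement G| by [].
have [P|nP] := has_patP G patP5 5.
  exists G; first by left.
  by apply: Or43; apply: S222_bundle => //; exact: sparse_P5.
have [P|nP'] := has_patP (complement G) patP5 5.
  exists (complement G); first by right.
  by apply: Or43; apply: S222_bundle => //; exact: sparse_P5.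
have nB : ~ has_pat G patBull 5.
  by move=> /(sparse_Bull prG G10 spG)[]; exact: sparse_Bull6.
have [|H HG [H1 H2]] := avoids_bad_bipartite prG G10; last by exists H => //; apply: Or42.
move=> ys uys sys; rewrite is_badE ?size_code ?sys // mem_undup !mem_cat; apply/negP.
case/or3P => /mapP[p pp cE].
- by apply: nP; exact: perm_has_pat patP5_sym _ uys sys pp cE.
(* A co-P5 of [G] is a P5 of its complement. *)
- apply: nP'; apply: has_pat_compl patP5_sym _.
  apply: perm_has_pat _ _ uys sys pp cE => // i j.
  by rewrite /patcoP5 eq_sym patP5_sym.
- by apply: nB; exact: perm_has_pat patBull_sym _ uys sys pp cE.
Qed.
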